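(* In the shock model described in the context, fix $t\ge0$. Let $\nu_t$ be the measure on $[0,\infty)$ whose Laplace transform is $$\tilde\nu_t(s)=\exp\left(-\Lambda(t)+\int_0^t q(w)\lambda(w)\tilde\mu(t-w,s)\,dw\right),\quad s\ge0,$$ where $\tilde\mu(u,s)=\iint_{\mathbb{R}_+^2}e^{-uv_1-sv_2}\mu(dv_1,dv_2)$ is the bivariate Laplace transform of $\mu$. Then $$\tilde\phi_t(s)=\tilde F_{G_t}(s)\,\tilde\nu_t(s)\quad\text{for all } s\ge0,$$ equivalently $\phi_t(L)=(F_{G_t}*\nu_t)(L)=\int_{[0,\infty)}F_{G_t}(L-x)\,\nu_t(dx)$ for all $L\ge0$, where $\tilde\phi_t(s)=\int_0^\infty e^{-sL}\phi_t(L)\,dL$ and $\tilde F_{G_t}(s)=\int_0^\infty e^{-sw}F_{G_t}(w)\,dw$. In the special case where $V^{(1)}$ and $V^{(2)}$ are independent, $\tilde\nu_t(s)=e^{-\Lambda(t)+a(t)\tilde\mu_2(s)}$, where $a(t)=\int_0^t\tilde\mu_1(t-w)q(w)\lambda(w)\,dw$ and $\tilde\mu_j(s)=\int_0^\infty e^{-xs}\mu_j(dx)$ is the Laplace transform of the distribution $\mu_j$ of $V^{(j)}$.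
   Context: Shock model. $(N_t)_{t\ge0}$ is a non-homogeneous Poisson process with intensity $\lambda(t)\,dt$ ($\lambda\ge0$), cumulated intensity $\Lambda(t)=\int_0^t\lambda(x)\,dx$, with $\Lambda(t)>0$ for all $t>0$; its points are $0<T_1<T_2<\cdots$. The random vectors $V_i=(V_i^{(1)},V_i^{(2)})$, $i\ge1$, are i.i.d. copies of a non-negative random vector $(V^{(1)},V^{(2)})$ with distribution $\mu$ and marginals $\mu_1,\mu_2$, independent of $(N_t)$. $(G_t)_{t\ge0}$ is a non-decreasing non-negative stochastic process independent of $(N_t)$ and the $V_i$; $F_{G_t}$ is the c.d.f. of $G_t$. $q:[0,\infty)\to[0,1]$. Empty sums are $0$, empty products are $1$. For $L\ge0$ define $$\phi_t(L)=\mathbb{E}\left(F_{G_t}\left(L-\sum_{i=1}^{N_t}V_i^{(2)}\right)e^{-\sum_{i=1}^{N_t}V_i^{(1)}(t-T_i)}\prod_{i=1}^{N_t}q(T_i)\right).$$ *)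

(* Defs.v *)
From mathcomp Require Import all_boot all_order all_algebra.
From mathcomp Require Import all_classical all_reals all_analysis.
Set Implicit Arguments. Unset Strict Implicit. Unset Printing Implicit Defensive.
Import Order.TTheory GRing.Theory Num.Theory.
Local Open Scope classical_set_scope.
Local Open Scope ring_scope.

Section shock.
Context {R : realType} {d : measure_display} {Omega : measurableType d}.
Variable P : probability Omega R.

Definition indep {I : eqType} (F : I -> set (set Omega)) : Prop :=
  forall (J : seq I) (A : I -> set Omega), uniq J ->
    (forall i, i \in J -> F i (A i)) ->
    fine (P (\big[setI/setT]_(i <- J) A i)) = \prod_(i <- J) fine (P (A i)).

Definition Lambda (lam : R -> R) (t : R) : R :=
  fine (\int[lebesgue_measure]_(x in `[0%R, t]%classic) (lam x)%:E)%E.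

Definition sigma_incr (N : R -> Omega -> nat) (a b : R) : set (set Omega) :=
  <<s [set A | exists k : nat, A = [set w | (N b w - N a w)%N = k]] >>.

(* (N_t)_{t>=0} is a non-homogeneous Poisson process with intensity lam and
   T i (i >= 1) is its i-th point (whenever the i-th point exists). *)
Definition nhpp (lam : R -> R) (N : R -> Omega -> nat) (T : nat -> Omega -> R)
  : Prop :=
  (forall t k, 0 <= t -> measurable [set w | N t w = k]) /\
      (forall w, N 0 w = 0%N) /\
      (forall w s t, 0 <= s <= t -> (N s w <= N t w)%N) /\
      (forall a b k, 0 <= a <= b ->
         fine (P [set w | (N b w - N a w)%N = k]) =
         expR (- (Lambda lam b - Lambda lam a)) *
           (Lambda lam b - Lambda lam a) ^+ k / (k`!)%:R) /\
      (forall (n : nat) (tt : nat -> R), 0 <= tt 0%N ->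
         (forall k, tt k <= tt k.+1) ->
         indep (fun k : 'I_n => sigma_incr N (tt k) (tt k.+1))) /\
      (forall i, measurable_fun setT (T i)) /\
      (forall w (i : nat) t s, (0 < i)%N -> 0 <= t -> (i <= N t w)%N -> 0 <= s ->
         (T i w <= s <-> (i <= N s w)%N)).

Definition sigmaN (N : R -> Omega -> nat) : set (set Omega) :=
  <<s [set A | exists t k, 0 <= t /\ A = [set w | N t w = k]] >>.
Definition sigmaV (V1 V2 : nat -> Omega -> R) (i : nat) : set (set Omega) :=
  [set A | exists B : set (R * R)%type, measurable B /\
           A = (fun w => (V1 i w, V2 i w)) @^-1` B].
Definition sigmaG (G : R -> Omega -> R) : set (set Omega) :=
  <<s [set A | exists t (B : set R), 0 <= t /\ measurable B /\ A = G t @^-1` B] >>.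

Definition shock_family N V1 V2 G (k : nat) : set (set Omega) :=
  match k with
  | 0%N => sigmaN N
  | 1%N => sigmaG G
  | i.+2 => sigmaV V1 V2 i.+1
  end.

Definition cdfG (X : Omega -> R) (x : R) : R := fine (P [set w | X w <= x]).

Definition shock_phi (N : R -> Omega -> nat) (T : nat -> Omega -> R)
  (V1 V2 : nat -> Omega -> R) (G : R -> Omega -> R) (q : R -> R) (t L : R) : R :=
  fine (\int[P]_w
    (cdfG (G t) (L - \sum_(1 <= i < (N t w).+1) V2 i w) *
     expR (- \sum_(1 <= i < (N t w).+1) (V1 i w * (t - T i w))) *
     \prod_(1 <= i < (N t w).+1) q (T i w))%:E)%E.

End shock.

Definition laplace {R : realType} (f : R -> R) (s : R) : \bar R :=
  (\int[lebesgue_measure]_(x in `[0%R, +oo[%classic) (expR (- (s * x)) * f x)%:E)%E.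

Definition mu_lt {R : realType} (mu : probability (R * R)%type R) (u s : R) : R :=
  fine (\int[mu]_v (expR (- (u * v.1) - s * v.2))%:E)%E.

Definition mu1_lt {R : realType} (mu : probability (R * R)%type R) (s : R) : R :=
  fine (\int[mu]_v (expR (- (s * v.1)))%:E)%E.
Definition mu2_lt {R : realType} (mu : probability (R * R)%type R) (s : R) : R :=
  fine (\int[mu]_v (expR (- (s * v.2)))%:E)%E.

Definition nu_exponent {R : realType} (lam q : R -> R)
  (mu : probability (R * R)%type R) (t s : R) : R :=
  - Lambda lam t +
  fine (\int[lebesgue_measure]_(w in `[0%R, t]%classic) (q w * lam w * mu_lt mu (t - w) s)%:E)%E.

Definition a_coef {R : realType} (lam q : R -> R)
  (mu : probability (R * R)%type R) (t : R) : R :=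
  fine (\int[lebesgue_measure]_(w in `[0%R, t]%classic) (mu1_lt mu (t - w) * q w * lam w)%:E)%E.

Definition is_nu {R : realType} (lam q : R -> R) (mu : probability (R * R)%type R)
  (t : R) (nu : {measure set R -> \bar R}) : Prop :=
  nu `]-oo, 0[%classic = 0%E /\
  forall s, 0 <= s ->
    (\int[nu]_(x in `[0%R, +oo[%classic) (expR (- (s * x)))%:E)%E = (expR (nu_exponent lam q mu t s))%:E.

(* Main.v *)
(* The measure nu_t is explicit: nu_t(B) = E(W; S in B), where S is the sum of
   the V_i^(2) and W the product of q(T_i) exp(-V_i^(1)(t - T_i)) over i <= N_t.
   With this measure the convolution formula is a change of variables, and the
   formula for the Laplace transforms follows from Tonelli's theorem and the
   translation invariance of Lebesgue measure.  (Only the law of G_t enters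
   phi_t, so that the independence of G from the rest plays no role.)

   The Laplace transform of nu_t is the expectation of the product of
   q(T_i) exp(-V_i^(1)(t - T_i) - s V_i^(2)).  Integrating the marks out one at
   a time turns it into the expectation of the product of h(T_i), with
   h(x) = q(x) mu~(t - x, s), and it remains to prove the formula
   E prod_(i <= N_t) h(T_i) = exp(- int_0^t (1 - h) lambda) of the Poisson
   process.  For a step function h this is the independence of the increments.
   Both sides are Lipschitz in h for the distance of L^1(lambda dx) (for the left
   side by Campbell's formula), and the step functions are dense there.

   Any measure with the same Laplace transform equals nu_t: on the moments of
   exp(-x) the two measures agree, hence on the Lipschitz functions of exp(-x), by
   approximation with Bernstein polynomials, and finally on half-lines. *)
Require Import Defs.
From HB Require Import structures.
From mathcomp Require Import all_boot all_order all_algebra finmap.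
From mathcomp Require Import all_classical all_reals all_analysis.
From mathcomp Require Import measurable_realfun ring lra.
Set Implicit Arguments. Unset Strict Implicit. Unset Printing Implicit Defensive.
Import Order.TTheory GRing.Theory Num.Theory.
Import numFieldNormedType.Exports.
Local Open Scope classical_set_scope.
Local Open Scope ring_scope.

(** * Weighted image measures *)

(** Independence is assumed only as a product formula for events, and no conditional expectation is
    formed. The passage from events to functions goes through weighted image measures: two weights
    with the same integral over every event [X in A] may be exchanged next to any non-negative
    function of [X]. The points are the main obstacle. [T i] is unconstrained where the [i]-th point
    does not exist, and the number [N t] of factors is random. Points that are not reached by time
    [t] are therefore moved to [t + 1], where all factors are set to 1. The modified points are
    measurable for the sigma-algebra of the counts, hence independent of the marks, and a product of
    fixed length [n] no longer changes once [n] reaches [N t]. The marks are integrated out at fixed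
    [n], and dominated convergence restores the random length. The law of the points given [N t]
    never appears: Campbell's formula compares two finite measures on half-lines, where the number
    of points is an increment of [N]. *)

Section wlaw.
Local Open Scope ereal_scope.
Context d1 d2 (T1 : measurableType d1) (T2 : measurableType d2) (R : realType).
Variables (mu : {measure set T1 -> \bar R}) (W : T1 -> R) (X : T1 -> T2).

(** The image under [X] of the measure with density [W] with respect to [mu]. It yields [nu_t], the
    intensity measure (with [X] the identity), the law of one point restricted to an event, and, for
    [W = 1], ordinary image measures. *)
Definition wlaw (A : set T2) : \bar R := \int[mu]_(w in X @^-1` A) (W w)%:E.

Hypotheses (mW : measurable_fun setT W) (W0 : forall w, (0 <= W w)%R).
Hypothesis mX : measurable_fun setT X.

Let mEW : measurable_fun setT (EFin \o W).
Proof. exact/measurable_EFinP. Qed.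

Let EW0 w : 0 <= (W w)%:E.
Proof. by rewrite lee_fin. Qed.

Let mXV A : measurable A -> measurable (X @^-1` A).
Proof. by move=> mA; rewrite -[X in measurable X]setTI; exact: mX. Qed.

Let wlaw0 : wlaw set0 = 0.
Proof. by rewrite /wlaw preimage_set0 integral_set0. Qed.

Let wlaw_ge0 A : 0 <= wlaw A.
Proof. exact: integral_ge0. Qed.

Let wlaw_sigma_additive : semi_sigma_additive wlaw.
Proof.
move=> F mF tF mUF; rewrite /wlaw preimage_bigcup ge0_integral_bigcup//.
- by apply: is_cvg_ereal_nneg_natsum => n _; exact: integral_ge0.
- by move=> k; exact: mXV.
- exact: measurable_funTS.
- apply/trivIsetP => i j _ _ ij; rewrite -preimage_setI.
  by move/trivIsetP : tF => ->//; rewrite preimage_set0.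
Qed.

HB.instance Definition _ := isMeasure.Build _ _ _ wlaw
  wlaw0 wlaw_ge0 wlaw_sigma_additive.

Definition wlaw_measure : {measure set T2 -> \bar R} := wlaw.

Let integral_wlaw_indic E : measurable E ->
  \int[wlaw]_x (\1_E x)%:E = \int[mu]_w ((\1_E (X w))%:E * (W w)%:E).
Proof.
move=> mE; rewrite integral_indic//= setIT /wlaw integral_mkcond.
apply: eq_integral => w _; rewrite patchE indicE.
have [wE|wE] := boolP (w \in X @^-1` E).
  by move: wE; rewrite !inE/= => wE; rewrite mem_set// mul1e.
by rewrite memNset ?mul0e// => XE; move: wE; rewrite notin_setE.
Qed.

Import HBNNSimple.

Let integral_wlaw_nnsfun (f : {nnsfun T2 >-> R}) :
  \int[wlaw]_x (f x)%:E = \int[mu]_w ((f (X w))%:E * (W w)%:E).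
Proof.
under [LHS]eq_integral do rewrite fimfunE -fsumEFin//.
rewrite [LHS]ge0_integral_fsum//; last 2 first.
  - by move=> r; exact/measurable_EFinP/measurableT_comp.
  - by move=> n x _; rewrite EFinM nnfun_muleindic_ge0.
under [RHS]eq_integral.
  move=> x xD; rewrite fimfunE -fsumEFin// muleC ge0_mule_fsumr; last first.
    by move=> r; rewrite EFinM nnfun_muleindic_ge0.
  over.
rewrite [RHS]ge0_integral_fsum//; last 2 first.
  - move=> r; apply: emeasurable_funM => //.
    apply/measurable_EFinP; apply: measurable_funM => //.
    by apply: measurableT_comp => //.
  - by move=> n x _; rewrite mule_ge0// EFinM nnfun_muleindic_ge0.
apply: eq_fsbigr => r _.
rewrite integralZl_indic_nnsfun//= integral_wlaw_indic//.
have [r0|r0] := ltP r 0%R.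
  rewrite preimage_nnfun0// [RHS]integral0_eq ?indic0/=; last first.
    by move=> x _; rewrite mulr0 mule0.
  by rewrite integral0_eq ?mule0// => w _; rewrite mul0e.
rewrite -ge0_integralZl//.
- by apply: eq_integral => w _; rewrite EFinM muleA muleC.
- apply: emeasurable_funM => //; apply/measurable_EFinP.
  exact: measurableT_comp.
- by move=> w _; rewrite mule_ge0// lee_fin.
Qed.

Lemma integral_wlaw (f : T2 -> \bar R) :
  measurable_fun setT f -> (forall x, 0 <= f x) ->
  \int[wlaw_measure]_x f x = \int[mu]_w (f (X w) * (W w)%:E).
Proof.
move=> mf f0; pose f_ := nnsfun_approx measurableT mf.
transitivity (limn (fun n => \int[wlaw]_x (f_ n x)%:E)); first rewrite /wlaw_measure.
  rewrite -monotone_convergence//=.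
  - apply: eq_integral => ? _; apply/esym/cvg_lim => //=.
    exact: cvg_nnsfun_approx.
  - by move=> n; exact/measurable_EFinP/measurable_funTS.
  - by move=> n ? _; rewrite lee_fin.
  - by move=> ? _ ? ? mn; rewrite lee_fin; exact/lefP/nd_nnsfun_approx.
under eq_fun do rewrite integral_wlaw_nnsfun.
rewrite -monotone_convergence//.
- apply: eq_integral => w _; apply/cvg_lim => //; apply: cvgeZr => //.
  exact: cvg_nnsfun_approx.
- move=> n; apply: emeasurable_funM => //.
  by apply/measurable_EFinP; exact: measurableT_comp.
- by move=> n w _; rewrite mule_ge0 ?lee_fin.
- move=> w _ a b ab; rewrite lee_wpmul2r ?lee_fin//.
  exact/lefP/nd_nnsfun_approx.
Qed.

End wlaw.

(** * Products of independent functions *)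

(** The hypothesis says that the two weighted images under [X] are the same measure. This is the
    tool that replaces a random weight by a simpler one in the presence of a function of [X]. *)
Lemma eq_wlaw_integral d1 d2 (T1 : measurableType d1) (T2 : measurableType d2)
    (R : realType) (mu : {measure set T1 -> \bar R}) (X : T1 -> T2)
    (W1 W2 : T1 -> R) (g : T2 -> \bar R) :
  measurable_fun setT X -> measurable_fun setT W1 -> measurable_fun setT W2 ->
  (forall w, 0 <= W1 w) -> (forall w, 0 <= W2 w) ->
  (forall A, measurable A -> \int[mu]_(w in X @^-1` A) (W1 w)%:E =
                             \int[mu]_(w in X @^-1` A) (W2 w)%:E)%E ->
  measurable_fun setT g -> (forall x, 0 <= g x)%E ->
  (\int[mu]_w (g (X w) * (W1 w)%:E) = \int[mu]_w (g (X w) * (W2 w)%:E))%E.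
Proof.
move=> mX mW1 mW2 W10 W20 W12 mg g0.
rewrite -(integral_wlaw mu mW1 W10 mX)// -(integral_wlaw mu mW2 W20 mX)//.
by apply: eq_measure_integral => A mA _; exact: W12.
Qed.

Lemma measurable_preimage d1 d2 (T1 : measurableType d1) (T2 : measurableType d2)
    (f : T1 -> T2) (A : set T2) :
  measurable_fun setT f -> measurable A -> measurable (f @^-1` A).
Proof. by move=> mf mA; rewrite -[X in measurable X]setTI; exact: mf. Qed.

Section integral01.
Context {R : realType} d (Omega : measurableType d) (P : probability Omega R).
Variable f : Omega -> R.
Hypotheses (mf : measurable_fun setT f) (f01 : forall w, 0 <= f w <= 1).

Lemma integral01_le1 : (\int[P]_w (f w)%:E <= 1)%E.
Proof.
apply: le_trans (_ : \int[P]_w (cst 1%E w) <= _)%E.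
  apply: ge0_le_integral => //.
  - by move=> w _; rewrite lee_fin; have /andP[] := f01 w.
  - exact/measurable_EFinP.
  - by move=> w _; rewrite lee_fin; have /andP[] := f01 w.
by rewrite integral_cst// mul1e probability_le1.
Qed.

Lemma integral01_fin_num : (\int[P]_w (f w)%:E)%E \is a fin_num.
Proof.
rewrite ge0_fin_numE; first exact: le_lt_trans integral01_le1 (ltry 1).
by apply: integral_ge0 => w _; rewrite lee_fin; have /andP[] := f01 w.
Qed.

End integral01.

Section indep_prod.
Context {R : realType} d (Omega : measurableType d) (P : probability Omega R).
Context (I : eqType) (F : I -> set (set Omega)).
Hypothesis indepF : indep P F.
Hypothesis measF : forall i, F i `<=` measurable.

Lemma integral_prod_indic (A : I -> set Omega) (J : seq I) : uniq J ->
  (forall i, i \in J -> F i (A i)) ->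
  (\int[P]_w (\prod_(i <- J) \1_(A i) w)%:E = (\prod_(i <- J) fine (P (A i)))%:E)%E.
Proof.
move=> uJ FA; rewrite -indepF//.
have mA : measurable (\big[setI/setT]_(i <- J) A i).
  elim: J uJ FA => [|i J IH] /= uJ FA; first by rewrite big_nil.
  rewrite big_cons; apply: measurableI; first by apply: measF; apply: FA; rewrite mem_head.
  by move: uJ => /andP[_ uJ]; apply: IH => // j jJ; apply: FA; rewrite in_cons jJ orbT.
rewrite fineK ?fin_num_measure// -[X in _ = P X]setIT -integral_indic//.
apply: eq_integral => w _; congr EFin.
elim: {uJ FA mA} J => [|i J IH]; first by rewrite !big_nil indicT.
by rewrite !big_cons indicI IH.
Qed.

Lemma integral_prod_indep_indic (f : I -> Omega -> R) (A : I -> set Omega)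
    (J K : seq I) : uniq (J ++ K) ->
  (forall i w, 0 <= f i w <= 1) ->
  (forall i, i \in J -> measurable_fun setT (f i)) ->
  (forall i B, i \in J -> measurable B -> F i (f i @^-1` B)) ->
  (forall i, i \in K -> F i (A i)) ->
  (\int[P]_w (\prod_(i <- J) f i w * \prod_(i <- K) \1_(A i) w)%:E =
   (\prod_(i <- J) fine (\int[P]_w (f i w)%:E) * \prod_(i <- K) fine (P (A i)))%:E)%E.
Proof.
move=> uJK f01; elim: J K A uJK => [|j J IH] K A uJK mf Ff FA.
  under eq_integral do rewrite big_nil mul1r.
  by rewrite big_nil mul1r integral_prod_indic.
have uJ : uniq (J ++ j :: K) by rewrite -cat1s uniq_catCA.
have jK : j \notin K by move: uJK => /= /andP[+ _]; rewrite mem_cat negb_or => /andP[].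
have {}IH A' := IH (j :: K) A' uJ (fun i iJ => mf i (mem_behead (s := j :: J) iJ))
  (fun i B iJ => Ff i B (mem_behead (s := j :: J) iJ)).
have mj : measurable_fun setT (f j) by apply: mf; rewrite mem_head.
set W := fun w => \prod_(i <- J) f i w * \prod_(i <- K) \1_(A i) w : R.
set c := \prod_(i <- J) fine (\int[P]_w (f i w)%:E)%E * \prod_(i <- K) fine (P (A i)).
have W0 w : 0 <= W w.
  by rewrite mulr_ge0// prodr_ge0// => i _; have /andP[] := f01 i w.
have c0 : 0 <= c.
  rewrite mulr_ge0// prodr_ge0// => i _; rewrite fine_ge0// integral_ge0// => w _.
  by rewrite lee_fin; have /andP[] := f01 i w.
have mW : measurable_fun setT W.
  apply: measurable_funM; apply: measurable_prod => i iJ.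
    by apply: mf; rewrite in_cons iJ orbT.
  by apply: measurable_indic; apply: measF; exact: FA.
have Wc B : measurable B -> (\int[P]_(w in f j @^-1` B) (W w)%:E =
    \int[P]_(w in f j @^-1` B) (cst c w)%:E)%E.
  move=> mB; have mfB : measurable (f j @^-1` B) by exact: measurable_preimage.
  rewrite [RHS](integral_cst P mfB c%:E).
  pose A' i := if i == j then f j @^-1` B else A i.
  have A'j : A' j = f j @^-1` B by rewrite /A' eqxx.
  have eqA' (T : Type) (idx : T) op (G : set Omega -> T) :
      \big[op/idx]_(i <- K) G (A' i) = \big[op/idx]_(i <- K) G (A i).
    apply: eq_big_seq => i iK; rewrite /A'; case: eqP => // ij.
    by move: jK; rewrite -ij iK.
  have := IH A'; rewrite big_cons (eqA' _ _ _ (fun A => fine (P A))) A'j.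
  rewrite mulrCA -/c mulrC EFinM fineK ?fin_num_measure// => <-; last first.
    move=> i; rewrite in_cons /A'; case: eqP => [-> _|_ /= iK]; last exact: FA.
    by apply: Ff; rewrite ?mem_head.
  rewrite integral_mkcond; apply: eq_integral => w _.
  rewrite big_cons (eqA' _ _ _ (fun A => \1_A w)) A'j patchE indicE /W.
  by case: ifPn => wB; rewrite ?(mul1r, mul0r, mulr0).
(* [eq_wlaw_integral] wants a test function that is non-negative on the whole line, so the identity
   is truncated at 0, which leaves [f j] unchanged. *)
have -> : (\int[P]_w (\prod_(i <- j :: J) f i w * \prod_(i <- K) \1_(A i) w)%:E =
    \int[P]_w ((Num.max (f j w) 0)%:E * (W w)%:E))%E.
  apply: eq_integral => w _; rewrite big_cons -EFinM /W mulrA (max_idPl _)//.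
  by have /andP[] := f01 j w.
rewrite (eq_wlaw_integral (g := fun x : R => (Num.max x 0)%:E) mj mW _ W0 (fun=> c0) Wc)//.
- rewrite /cst ge0_integralZr//.
  + rewrite big_cons -mulrA -/c EFinM fineK; first congr (_ * _)%E.
      by apply: eq_integral => w _; rewrite (max_idPl _)//; have /andP[] := f01 j w.
    exact: integral01_fin_num.
  + apply/measurable_EFinP; exact: measurable_maxr.
  + by move=> w _; rewrite lee_fin le_max lexx orbT.
- by apply/measurable_EFinP; exact: measurable_maxr.
- by move=> x; rewrite lee_fin le_max lexx orbT.
Qed.

Lemma integral_prod_indep (f : I -> Omega -> R) (J : seq I) : uniq J ->
  (forall i w, 0 <= f i w <= 1) ->
  (forall i, i \in J -> measurable_fun setT (f i)) ->
  (forall i B, i \in J -> measurable B -> F i (f i @^-1` B)) ->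
  (\int[P]_w (\prod_(i <- J) f i w)%:E =
   (\prod_(i <- J) fine (\int[P]_w (f i w)%:E))%:E)%E.
Proof.
move=> uJ f01 mf Ff.
have := @integral_prod_indep_indic f (fun=> setT) J [::].
rewrite cats0 => /(_ uJ f01 mf Ff) => H; rewrite big_nil mulr1 in H.
by rewrite -H//; apply: eq_integral => w _; rewrite big_nil mulr1.
Qed.

End indep_prod.

(** * Uniqueness of Laplace transforms *)

(** Half-lines are stable under intersection and generate the Borel sets, and the half-lines []-k,
    +oo[], of finite mass, exhaust the line. *)
Lemma measure_rays_unique (R : realType)
    (m1 m2 : {measure set (measurableTypeR R) -> \bar R}) :
  (forall b : R, m1 `]b, +oo[%classic = m2 `]b, +oo[%classic) ->
  (m1 setT < +oo)%E -> forall A, measurable A -> m1 A = m2 A.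
Proof.
move=> m12 m1oo A mA.
pose g (k : nat) : set R := `](- k%:R), +oo[%classic.
apply: (@measure_unique _ R (measurableTypeR R) (@RGenOInfty.G R) g).
- exact: RGenOInfty.measurableE.
- move=> _ _ [a ->] [b ->]; exists (Num.max a b).
  by apply/seteqP; split=> x /=; rewrite !in_itv/= !andbT gt_max => /andP.
- by move=> k; exists (- k%:R).
- apply/seteqP; split => // x _; exists (Num.truncn `|x|).+1 => //=.
  rewrite /g/= in_itv/= andbT ltrNl (le_lt_trans _ (truncnS_gt _))//.
  by rewrite -normrN ler_norm.
- by move=> _ [b ->].
- move=> k; apply: le_lt_trans m1oo; apply: le_measure; rewrite ?inE//=.
  exact: measurable_itv.
- exact: mA.
Qed.

Lemma bounded_measurable_integrable (R : realType) d (T : measurableType d)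
    (m : {measure set T -> \bar R}) (A : set T) (f : T -> R) (M : R) :
  measurable A -> (m A < +oo)%E -> measurable_fun setT f ->
  (forall x, A x -> `|f x| <= M) -> m.-integrable A (EFin \o f).
Proof.
move=> mA Aoo mf fM; apply: measurable_bounded_integrable => //.
  exact: measurable_funTS.
exists M; split; first exact: num_real.
by move=> N MN x Ax /=; exact: le_trans (fM _ Ax) (ltW MN).
Qed.

(** * Approximation of Lipschitz functions on the unit interval by Bernstein polynomials *)

Section bernstein.
Context {R : realType}.

(* The Bernstein polynomial sum_k f k 'C(n, k) X^k (1 - X)^(n - k), through its
   Pascal recursion. *)
Fixpoint bernstein (n : nat) (f : nat -> R) : {poly R} :=
  if n is n'.+1 then
    'X * bernstein n' (f \o S) + (1 - 'X) * bernstein n' f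
  else (f 0%N)%:P.

Lemma bernstein_le n (f g : nat -> R) (y : R) : 0 <= y <= 1 ->
  (forall k, f k <= g k) -> (bernstein n f).[y] <= (bernstein n g).[y].
Proof.
move=> /andP[y0 y1]; elim: n f g => [|n IH] f g fg /=; first by rewrite !hornerC.
rewrite !hornerE; apply: lerD; apply: ler_wpM2l; rewrite ?subr_ge0//.
  by apply: IH => k; exact: fg.
exact: IH.
Qed.

(** These are the first two moments of the binomial law with parameters [n] and [y]. The shift in
    the recursion maps quadratics to quadratics, so the induction closes for general [a], [b],
    [c]. *)
Lemma bernstein_quadratic n (a b c y : R) :
  (bernstein n (fun k => a + b * k%:R + c * k%:R ^+ 2)).[y] =
  a + b * (n%:R * y) + c * (n%:R * y * (1 - y) + (n%:R * y) ^+ 2).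
Proof.
elim: n a b c => [|n IH] a b c /=; first by rewrite hornerC; ring.
have -> : (fun k => a + b * k%:R + c * k%:R ^+ 2) \o S =
    (fun k => (a + b + c) + (b + c *+ 2) * k%:R + c * k%:R ^+ 2).
  by apply/funext => k /=; rewrite -[k.+1%:R]natr1; ring.
by rewrite !(hornerD, hornerM, hornerN, hornerX, hornerC) !IH -natr1; ring.
Qed.

(** The Bernstein operator is monotone in [f] and explicit on quadratics. The bound [K * |x - y|] is
    therefore weakened to the quadratic [K * (D + (x - y)^2 / D)], and monotonicity carries it over
    to the polynomial from both sides. *)
Lemma lipschitz_poly_approx (f : R -> R) (K e : R) : 0 <= K -> 0 < e ->
  (forall x y, `|f x - f y| <= K * `|x - y|) ->
  exists p : {poly R}, forall y, 0 <= y <= 1 -> `|p.[y] - f y| <= e.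
Proof.
move=> K0 e0 fK.
(* The final error is [K * (D + y * (1 - y) / (n * D))]. Choosing [n > 1 / D^2] makes the second
   term at most [D], so the error is at most [2 * K * D <= e]; using [K + 1] avoids a division by
   zero. *)
pose D := e / (K + 1) / 2.
have K10 : 0 < K + 1 by rewrite ltr_wpDl.
have D0 : 0 < D by rewrite !divr_gt0.
pose n := (Num.truncn (1 / D ^+ 2)).+1.
have n0 : 0 < n%:R :> R by rewrite ltr0n.
have nD : (n%:R * D)^-1 <= D.
  have := truncnS_gt (1 / D ^+ 2); rewrite -/n ltr_pdivrMr ?exprn_gt0// => nD.
  have nD0 : 0 < n%:R * D by rewrite mulr_gt0.
  rewrite -div1r ler_pdivrMr//.
  by rewrite mulrCA -expr2 ltW.
have KD : K * (D + D) <= e.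
  have -> : D + D = e / (K + 1) by rewrite /D -splitr.
  by rewrite mulrCA ler_piMr ?ltW// ltr_pdivrMr// mul1r ltrDl.
exists (bernstein n (fun k => f (k%:R / n%:R))) => y y01.
have /andP[y0 y1] := y01.
(* AM-GM: |u| <= D + u^2 / D *)
have amgm u : `|u| <= D + u ^+ 2 / D.
  rewrite -(ler_pM2r D0) mulrDl divfK ?gt_eqF// -real_normK ?num_real//.
  nra.
(* The sign [s] is [1] for the upper bound and [-1] for the lower one. *)
have var s : (bernstein n (fun k => f y + s * (K * (D + (k%:R / n%:R - y) ^+ 2 / D)))).[y]
    = f y + s * (K * (D + y * (1 - y) / (n%:R * D))).
  rewrite [X in bernstein n X](_ : _ = fun k =>
      (f y + s * K * (D + y ^+ 2 / D)) + (- s * K * 2 * y / (n%:R * D)) * k%:R +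
      (s * K / (n%:R ^+ 2 * D)) * k%:R ^+ 2).
    rewrite bernstein_quadratic; field.
    by rewrite !gt_eqF.
  apply/funext => k; field; by rewrite !gt_eqF.
have err : K * (D + y * (1 - y) / (n%:R * D)) <= e.
  apply: le_trans KD; rewrite ler_wpM2l// lerD2l.
  have yy : y * (1 - y) <= 1 by have := sqr_ge0 y; lra.
  by apply: le_trans nD; rewrite ler_piMl// invr_ge0 ltW// mulr_gt0.
have fk k : `|f (k%:R / n%:R) - f y| <= K * (D + (k%:R / n%:R - y) ^+ 2 / D).
  by apply: le_trans (fK _ _) _; rewrite ler_wpM2l.
rewrite ler_distl; apply/andP; split.
- apply: (@le_trans _ _ (bernstein n (fun k => f y + (-1) * (K * (D + (k%:R / n%:R - y) ^+ 2 / D)))).[y]).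
    by rewrite var mulN1r lerD2l lerN2.
  apply: bernstein_le => // k.
  by have := fk k; rewrite ler_distl mulN1r => /andP[].
- apply: (@le_trans _ _ (bernstein n (fun k => f y + 1 * (K * (D + (k%:R / n%:R - y) ^+ 2 / D)))).[y]).
    apply: bernstein_le => // k.
    by have := fk k; rewrite ler_distl mul1r => /andP[].
  by rewrite var mul1r lerD2l.
Qed.

End bernstein.

(** * A finite measure on the half-line is determined by its Laplace transform *)

Section laplace_unique.
Context {R : realType}.
Implicit Types m : {measure set (measurableTypeR R) -> \bar R}.
Local Notation D := `[0%R, +oo[%classic.

Let mD : measurable (D : set (measurableTypeR R)).
Proof. exact: measurable_itv. Qed.

Let expRN01 (x : R) : D x -> 0 <= expR (- x) <= 1.
Proof. by rewrite /= in_itv/= andbT => x0; rewrite expR_ge0 expR_le1 lerNl oppr0. Qed.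

Let mexpRN : measurable_fun (setT : set (measurableTypeR R)) (fun x => expR (- x)).
Proof. exact: measurableT_comp. Qed.

Let intm m (f : R -> R) (M : R) : (m D < +oo)%E -> measurable_fun setT f ->
  (forall y, 0 <= y <= 1 -> `|f y| <= M) ->
  m.-integrable D (EFin \o (fun x => f (expR (- x)))).
Proof.
move=> Doo mf fM; apply: (@bounded_measurable_integrable _ _ _ _ _ _ M) => //.
  exact: measurableT_comp.
by move=> x /expRN01; exact: fM.
Qed.

Let poly_bound (p : {poly R}) : exists M, forall y, 0 <= y <= 1 -> `|p.[y]| <= M.
Proof.
exists (\sum_(i < size p) `|p`_i|) => y /andP[y0 y1].
rewrite horner_coef; apply: le_trans (ler_norm_sum _ _ _) _.
apply: ler_sum => i _; rewrite normrM ler_piMr// normrX ger0_norm//.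
exact: exprn_ile1.
Qed.

Variables m1 m2 : {measure set (measurableTypeR R) -> \bar R}.
Variable c : R -> R.
Hypothesis m1N : m1 `]-oo, 0[%classic = 0%E.
Hypothesis m2N : m2 `]-oo, 0[%classic = 0%E.
Hypothesis m1E : forall s, 0 <= s ->
  (\int[m1]_(x in D) (expR (- (s * x)))%:E)%E = (c s)%:E.
Hypothesis m2E : forall s, 0 <= s ->
  (\int[m2]_(x in D) (expR (- (s * x)))%:E)%E = (c s)%:E.

Let mDE m : (\int[m]_(x in D) (expR (- (0 * x)))%:E)%E = (c 0)%:E -> m D = (c 0)%:E.
Proof.
by under eq_integral do rewrite mul0r oppr0 expR0; rewrite integral_cst// mul1e.
Qed.

Let m1D : m1 D = (c 0)%:E. Proof. exact/mDE/m1E. Qed.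
Let m2D : m2 D = (c 0)%:E. Proof. exact/mDE/m2E. Qed.
Let m1Doo : (m1 D < +oo)%E. Proof. by rewrite m1D ltry. Qed.
Let m2Doo : (m2 D < +oo)%E. Proof. by rewrite m2D ltry. Qed.

Let int_poly (p : {poly R}) :
  Rintegral m1 D (fun x => p.[expR (- x)]) = Rintegral m2 D (fun x => p.[expR (- x)]).
Proof.
have [M pM] := poly_bound p.
(* Since [expR (- x) ^+ i] is [expR (- (i * x))], the moment of order [i] is the transform at the
   integer [i]. *)
suff H m : (m D < +oo)%E -> (forall s, 0 <= s ->
    (\int[m]_(x in D) (expR (- (s * x)))%:E)%E = (c s)%:E) ->
    Rintegral m D (fun x => p.[expR (- x)]) = \sum_(i < size p) p`_i * c i%:R.
  by rewrite !H.
move=> mDoo mE; under eq_Rintegral do rewrite horner_coef.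
elim: (size p) => [|n IH].
  by under eq_Rintegral do rewrite big_ord0; rewrite big_ord0 Rintegral_cst// mul0r.
under eq_Rintegral do rewrite big_ord_recr/=.
have bX k (a : R) (y : R) : 0 <= y <= 1 -> `|a * y ^+ k| <= `|a|.
  move=> /andP[y0 y1]; rewrite normrM ler_piMr// normrX ger0_norm//.
  exact: exprn_ile1.
rewrite RintegralD//.
- rewrite IH big_ord_recr/=; congr (_ + _).
  rewrite RintegralZl//; last first.
    apply: (intm (f := fun y => y ^+ n) (M := 1)) => //.
    by move=> y y01; have := bX n 1 y y01; rewrite mul1r normr1.
  congr (_ * _); rewrite /Rintegral.
  rewrite -[RHS]/(fine (c n%:R)%:E) -mE//; congr fine; apply: eq_integral => x _.
  by rewrite -expRM_natl mulrN.
- apply: (intm (f := fun y => \sum_(i < n) p`_i * y ^+ i) (M := \sum_(i < n) `|p`_i|)) => //.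
    by apply: measurable_sum => i; apply: measurable_funM => //; exact: measurable_funX.
  move=> y y01; apply: le_trans (ler_norm_sum _ _ _) _.
  by apply: ler_sum => i _; exact: bX.
- apply: (intm (f := fun y => p`_n * y ^+ n) (M := `|p`_n|)) => //.
    by apply: measurable_funM => //; exact: measurable_funX.
  by move=> y; exact: bX.
Qed.

Let int_lipschitz (f : R -> R) (K M : R) : 0 <= K -> measurable_fun setT f ->
  (forall x y, `|f x - f y| <= K * `|x - y|) -> (forall x, `|f x| <= M) ->
  Rintegral m1 D (fun x => f (expR (- x))) = Rintegral m2 D (fun x => f (expR (- x))).
Proof.
move=> K0 mf fK fM; apply/eqP; rewrite -subr_eq0 -normr_le0; apply/ler_addgt0Pr => e e0.
have c0 : 0 <= c 0 by rewrite -lee_fin -m1D.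
(* [c 0] is the common mass of the half-line. Each measure contributes an error [e' * c 0], and the
   two together stay below [e]; the [+ 1] covers zero mass. *)
pose e' := e / (2 * (c 0 + 1)).
have e'0 : 0 < e' by rewrite divr_gt0// mulr_gt0// ltr_wpDl.
have [p pf] := lipschitz_poly_approx K0 e'0 fK.
have [N pN] := poly_bound p.
have near m : m D = (c 0)%:E ->
    `|Rintegral m D (fun x => f (expR (- x))) - Rintegral m D (fun x => p.[expR (- x)])|
    <= e' * c 0.
  move=> mDc; have mDoo : (m D < +oo)%E by rewrite mDc ltry.
  have i1 : m.-integrable D (EFin \o (fun x => f (expR (- x)))) by apply: (intm (M := M)) => // y _; exact: fM.
  have i2 : m.-integrable D (EFin \o (fun x => p.[expR (- x)])).
    by apply: (intm (f := horner p) (M := N)) => //; exact: measurable_poly.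
  have i3 : m.-integrable D
      (EFin \o (fun x => f (expR (- x)) - p.[expR (- x)])) by exact: (integrableB mD i1 i2).
  rewrite -RintegralB//; apply: le_trans (le_normr_Rintegral _ _) _ => //.
  apply: (@le_trans _ _ (Rintegral m D (cst e'))); last first.
    by rewrite Rintegral_cst// mDc.
  apply: le_Rintegral => //.
  - exact: integrable_norm i3.
  - by apply: (@bounded_measurable_integrable _ _ _ _ _ _ `|e'|).
  - by move=> x /expRN01 x01; rewrite distrC pf.
have := near _ m1D; have := near _ m2D; rewrite int_poly.
set a := Rintegral _ _ _; set b := Rintegral _ _ _; set r := Rintegral _ _ _.
rewrite (distrC a) => ab rb; rewrite add0r.
have -> : r - a = (r - b) + (b - a) by ring.
apply: le_trans (ler_normD _ _) _; apply: le_trans (lerD rb ab) _.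
have c10 : 0 < c 0 + 1 by rewrite ltr_wpDl.
have -> : e' * c 0 + e' * c 0 = e * (c 0 / (c 0 + 1)).
  by rewrite /e'; field; rewrite gt_eqF.
by rewrite ler_piMr ?ltW// ltr_pdivrMr// mul1r ltrDl.
Qed.

Let itv0U : setT = `]-oo, 0[%classic `|` D :> set R.
Proof.
by apply/seteqP; split => // x _ /=; rewrite !in_itv/= andbT; case: ltP; [left|right].
Qed.

Let itv0I : `]-oo, 0[%classic `&` D = set0 :> set R.
Proof.
by apply/seteqP; split => // x /= []; rewrite !in_itv/= andbT leNgt => ->.
Qed.

Lemma laplace_transform_unique_mR A : measurable A -> m1 A = m2 A.
Proof.
have mray (b : R) : measurable (`]b, +oo[%classic : set (measurableTypeR R)).
  exact: measurable_itv.
have mrayD m (b : R) : m `]-oo, 0[%classic = 0%E ->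
    m `]b, +oo[%classic = m (`]b, +oo[%classic `&` D).
  move=> mN; rewrite -[in LHS](setIT `]b, +oo[%classic).
  rewrite [X in _ `&` X]itv0U setIUr measureU//; last 3 first.
  - by apply: measurableI => //; exact: measurable_itv.
  - exact: measurableI.
  - by rewrite setIACA [X in _ `&` X]itv0I setI0.
  rewrite (subset_measure0 (B := `]-oo, 0[%classic : set (measurableTypeR R))) ?add0e//.
  - by apply: measurableI => //; exact: measurable_itv.
apply: measure_rays_unique; last first.
  rewrite [X in m1 X]itv0U measureU//.
  - by rewrite [X in (X + _)%E](_ : _ = 0%E) ?add0e.
move=> b; rewrite !mrayD//.
(* [phi k] is Lipschitz with constant [k] and increases with [k] to the indicator of
   [y < expR (- b)], which for [y = expR (- x)] is the half-line [b < x]. *)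
pose phi (k : nat) (y : R) : R := Num.min 1 (Num.max 0 (k%:R * (expR (- b) - y))).
have phi0 k y : 0 <= phi k y by rewrite le_min ler01 le_max lexx.
have phi1 k y : `|phi k y| <= 1 by rewrite ger0_norm// ge_min lexx.
have mphi k : measurable_fun setT (phi k).
  apply: measurable_minr => //; apply: measurable_maxr => //.
  by apply: measurable_funM => //; exact: measurable_funB.
have phiK k x y : `|phi k x - phi k y| <= k%:R * `|x - y|.
  have k0 : 0 <= k%:R :> R by [].
  set u := k%:R * (expR (- b) - x); set v := k%:R * (expR (- b) - y).
  have -> : k%:R * `|x - y| = `|u - v|.
    by rewrite -{1}(ger0_norm k0) -normrM -normrN; congr `|_|; rewrite /u /v; ring.
  have uv := ler_norm (u - v); have vu := ler_norm (v - u).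
  rewrite distrC in vu; rewrite /phi -/u -/v; move: uv vu (normr_ge0 (u - v)).
  move: `|u - v| => w uv vu w0; rewrite /Num.min /Num.max ler_norml.
  by apply/andP; split; do ! case: ifPn; rewrite -?leNgt; lra.
have phiE m : m D = (c 0)%:E -> m (`]b, +oo[%classic `&` D) =
    limn (fun k => (\int[m]_(x in D) (phi k (expR (- x)))%:E)%E).
  move=> mDc; rewrite -monotone_convergence//.
  - rewrite -integral_indic//; apply: eq_integral => x xD.
    apply/esym/cvg_lim => //; rewrite indicE.
    have [bx|bx] := ltP b x.
      rewrite mem_set/= ?in_itv/= ?andbT//; apply: cvg_near_cst.
      have d0 : 0 < expR (- b) - expR (- x) by rewrite subr_gt0 ltr_expR ltrN2.
      exists (Num.truncn (expR (- b) - expR (- x))^-1).+1 => // k /= lek.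
      apply/esym; congr EFin; rewrite /phi (max_idPr _); last first.
        by rewrite mulr_ge0// ltW.
      rewrite (min_idPl _)//.
      rewrite -ler_pdivrMr// div1r; apply: ltW; apply: lt_le_trans (truncnS_gt _) _.
      by rewrite ler_nat.
    rewrite memNset/= ?in_itv/= ?andbT; last by apply/negP; rewrite -leNgt.
    rewrite (_ : (fun _ => _) = cst 0%E); first exact: cvg_cst.
    apply/funext => k /=; congr EFin; rewrite /phi (max_idPl _) ?(min_idPr _)//.
    by rewrite mulr_ge0_le0// subr_le0 ler_expR lerN2.
  - move=> n; apply/measurable_EFinP/measurable_funTS; exact: measurableT_comp.
  - by move=> n x _; rewrite lee_fin.
  - move=> x _ i j ij; rewrite lee_fin.
    rewrite /phi le_min2//; have [u0|/ltW u0] := leP 0 (expR (- b) - expR (- x)).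
      by rewrite le_max2// ler_wpM2r// ler_nat.
    by rewrite !(max_idPl _)// mulr_ge0_le0.
rewrite (phiE m1)// (phiE m2)//; congr (limn _); apply/funext => k.
have h := int_lipschitz (ler0n _ k) (mphi k) (phiK k) (phi1 k).
have fin m : (m D < +oo)%E -> (\int[m]_(x in D) (phi k (expR (- x)))%:E)%E \is a fin_num.
  move=> mDoo; apply: integrable_fin_num => //.
  by apply: (@intm m (phi k) 1).
by rewrite -[LHS]fineK ?fin// -[RHS]fineK ?fin//; congr EFin.
Qed.

End laplace_unique.

(* [R] and [measurableTypeR R] have the same measurable sets but different
   measure displays, so that their types of measures are not convertible. *)
Lemma laplace_transform_unique (R : realType) (m1 m2 : {measure set R -> \bar R})
    (c : R -> R) :
  m1 `]-oo, 0[%classic = 0%E -> m2 `]-oo, 0[%classic = 0%E ->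
  (forall s, 0 <= s ->
    (\int[m1]_(x in `[0%R, +oo[%classic) (expR (- (s * x)))%:E)%E = (c s)%:E) ->
  (forall s, 0 <= s ->
    (\int[m2]_(x in `[0%R, +oo[%classic) (expR (- (s * x)))%:E)%E = (c s)%:E) ->
  forall A, measurable A -> m1 A = m2 A.
Proof.
move=> m1N m2N m1E m2E A mA.
(* The identity is measurable from one structure to the other, so the image measure with weight 1
   carries [m] over. *)
have mid : measurable_fun setT (idfun : R -> measurableTypeR R).
  by move=> _ B mB; rewrite setTI.
have m_1 : measurable_fun [set: R] (cst (1 : R)) by [].
have p0 : forall x : R, 0 <= cst (1 : R) x by [].
have toR (m : {measure set R -> \bar R}) (B : set R) : measurable B ->
    wlaw_measure m m_1 p0 mid B = m B.
  move=> mB; rewrite /= /wlaw_measure /wlaw (eq_integral (cst 1%E))// integral_cst//.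
  by rewrite mul1e.
have toRE (m : {measure set R -> \bar R}) s : 0 <= s ->
    (\int[wlaw_measure m m_1 p0 mid]_(x in `[0%R, +oo[%classic) (expR (- (s * x)))%:E =
     \int[m]_(x in `[0%R, +oo[%classic) (expR (- (s * x)))%:E)%E.
  move=> s0; rewrite integral_mkcond integral_wlaw.
  - rewrite [RHS]integral_mkcond; apply: eq_integral => x _.
    by rewrite /= mule1.
  - apply/(measurable_restrictT _ _).1 => //.
    apply/measurable_EFinP/measurable_funTS; apply: measurableT_comp => //.
    by apply: measurableT_comp => //; exact: measurable_funM.
  - by apply: erestrict_ge0 => x _; rewrite lee_fin expR_ge0.
rewrite -(toR m1)// -(toR m2)//.
apply: (laplace_transform_unique_mR (c := c)) => //.
- by rewrite toR.
- by rewrite toR.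
- by move=> s s0; rewrite toRE// m1E.
- by move=> s s0; rewrite toRE// m2E.
Qed.

(** * Density of step functions *)

Section step_density.
Context {R : realType}.
Local Notation mR := (measurableTypeR R).
Variable m : {measure set mR -> \bar R}.
Hypothesis moo : (m setT < +oo)%E.

(** [h] is constant on the intervals cut out by the thresholds in [s], which need be neither sorted
    nor distinct: two partitions are refined by concatenating the lists. The intervals are open on
    the left and closed on the right, to match the increments of [N]. *)
Definition step_fun (s : seq R) (h : R -> R) : Prop :=
  forall x y, (forall a, a \in s -> (x <= a) = (y <= a)) -> h x = h y.

Definition step_approx (g : R -> R) : Prop := forall e, 0 < e -> exists h s,
  [/\ step_fun s h, measurable_fun (setT : set mR) h &
      (\int[m]_x (`|g x - h x|)%:E <= e%:E)%E].

Let mdist (g h : R -> R) : measurable_fun (setT : set mR) g ->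
  measurable_fun (setT : set mR) h ->
  measurable_fun (setT : set mR) (fun x => (`|g x - h x|)%:E).
Proof.
by move=> mg mh; apply/measurable_EFinP; apply: measurableT_comp => //;
  exact: measurable_funB.
Qed.

Let dist_split (g h g1 h1 g2 h2 : R -> R) (e : R) :
  measurable_fun (setT : set mR) g -> measurable_fun (setT : set mR) h ->
  measurable_fun (setT : set mR) g1 -> measurable_fun (setT : set mR) h1 ->
  measurable_fun (setT : set mR) g2 -> measurable_fun (setT : set mR) h2 ->
  (forall x, `|g x - h x| <= `|g1 x - h1 x| + `|g2 x - h2 x|) ->
  (\int[m]_x (`|g1 x - h1 x|)%:E <= (e / 2)%:E)%E ->
  (\int[m]_x (`|g2 x - h2 x|)%:E <= (e / 2)%:E)%E ->
  (\int[m]_x (`|g x - h x|)%:E <= e%:E)%E.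
Proof.
move=> mg mh mg1 mh1 mg2 mh2 gh e1 e2.
apply: (@le_trans _ _ (\int[m]_x ((`|g1 x - h1 x|)%:E + (`|g2 x - h2 x|)%:E))%E).
  apply: ge0_le_integral => //.
  - exact: mdist.
  - by apply: emeasurable_funD; exact: mdist.
  - by move=> x _; rewrite -EFinD lee_fin.
rewrite ge0_integralD//; [|exact: mdist|exact: mdist].
by rewrite [e]splitr EFinD leeD.
Qed.

Lemma step_approxD (g1 g2 : R -> R) : measurable_fun (setT : set mR) g1 ->
  measurable_fun (setT : set mR) g2 ->
  step_approx g1 -> step_approx g2 -> step_approx (fun x => g1 x + g2 x).
Proof.
move=> mg1 mg2 a1 a2 e e0; have e20 : 0 < e / 2 by rewrite divr_gt0.
have [h1 [s1 [sh1 mh1 d1]]] := a1 _ e20.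
have [h2 [s2 [sh2 mh2 d2]]] := a2 _ e20.
exists (fun x => h1 x + h2 x), (s1 ++ s2); split.
- move=> x y xy; congr (_ + _).
    by apply: sh1 => a as1; apply: xy; rewrite mem_cat as1.
  by apply: sh2 => a as2; apply: xy; rewrite mem_cat as2 orbT.
- exact: measurable_funD.
- apply: (dist_split _ _ mg1 mh1 mg2 mh2) => //; try exact: measurable_funD.
  by move=> x; rewrite opprD addrACA ler_normD.
Qed.

Lemma step_approxZ c (g : R -> R) : measurable_fun (setT : set mR) g ->
  step_approx g -> step_approx (fun x => c * g x).
Proof.
move=> mg ag e e0; have c0 : 0 < `|c| + 1 by rewrite ltr_wpDl.
have [h [s [sh mh d]]] := ag _ (divr_gt0 e0 c0).
exists (fun x => c * h x), s; split.
- by move=> x y xy; rewrite (sh x y).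
- exact: measurable_funM.
- under eq_integral do rewrite -mulrBr normrM EFinM.
  rewrite ge0_integralZl//; last exact: mdist.
  apply: le_trans (lee_wpmul2l _ d) _; first by rewrite lee_fin.
  rewrite -EFinM lee_fin mulrCA ler_piMr ?ltW// ltr_pdivrMr// mul1r.
  by rewrite ltrDl.
Qed.

Lemma step_approx_lim (g : R -> R) : measurable_fun (setT : set mR) g ->
  (forall e, 0 < e -> exists g' : R -> R, [/\ measurable_fun (setT : set mR) g', step_approx g' &
     (\int[m]_x (`|g x - g' x|)%:E <= e%:E)%E]) -> step_approx g.
Proof.
move=> mg H e e0; have e20 : 0 < e / 2 by rewrite divr_gt0.
have [g' [mg' ag' d]] := H _ e20.
have [h [s [sh mh d']]] := ag' _ e20.
exists h, s; split => //; apply: (dist_split mg mh mg mg' mg' mh) => // x.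
exact: ler_distD.
Qed.

Let step_approx_step s h : step_fun s h -> measurable_fun (setT : set mR) h ->
  step_approx h.
Proof.
move=> sh mh e e0; exists h, s; split => //.
by under eq_integral do rewrite subrr normr0; rewrite integral0 lee_fin ltW.
Qed.

(** The sets with an approximable indicator form a Dynkin system that contains the half-lines.
    Complements use linearity; a disjoint union is the limit of its finite subunions, whose
    indicators are sums. *)
Lemma step_approx_indic (A : set mR) : measurable A -> step_approx \1_A.
Proof.
move=> mA.
apply: (@dynkin_induction _ mR (@RGenOInfty.G R)
  [set A | measurable A -> step_approx \1_A]) => //=.
- exact: RGenOInfty.measurableE.
- move=> _ _ [a ->] [b ->]; exists (Num.max a b).
  by apply/seteqP; split=> x /=; rewrite !in_itv/= !andbT gt_max => /andP.
- move=> _; rewrite indicT; apply: (@step_approx_step [::]) => //.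
- move=> _ [b ->] mb; apply: (@step_approx_step [:: b]); last exact: measurable_indic.
  move=> x y /(_ b); rewrite mem_head => /(_ isT) xy.
  by rewrite !indicE !mem_setE !in_itv/= !andbT !ltNge xy.
- move=> S mS + mSC => /(_ mS) aS.
  have -> : \1_(~` S) = (fun x => 1 + (-1) * \1_S x) :> (mR -> R).
    by apply/funext => x; rewrite indicC indicE; case: (_ \in _); rewrite /=; ring.
  apply: step_approxD => //.
  + by apply: measurable_funM => //; exact: measurable_indic.
  + by apply: (@step_approx_step [::]).
  + by apply: step_approxZ => //; exact: measurable_indic.
- move=> F mF tF aF mUF; apply: step_approx_lim; first exact: measurable_indic.
  move=> e e0; pose U n := \big[setU/set0]_(k < n) F k.
  have mU n : measurable (U n) by apply: bigsetU_measurable.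
  have aU n : step_approx \1_(U n).
    elim: n => [|n IH].
      rewrite /U big_ord0 indic0; apply: (@step_approx_step [::]) => //.
    have -> : \1_(U n.+1) = (fun x => \1_(U n) x + \1_(F n) x) :> (mR -> R).
      rewrite /U big_ord_recr/= -/(U n); apply/funext => x.
      rewrite !indicE in_setU; have [xU|] := boolP (x \in U n); last by rewrite add0r.
      have [xF|] := boolP (x \in F n); last by rewrite addr0.
      move: xU xF; rewrite !inE /U -bigcup_mkord => -[k /= kn Fkx] Fnx.
      have kE : k = n by apply: tF => //; exists x.
      by move: kn; rewrite kE ltnn.
    apply: step_approxD; [exact: measurable_indic|exact: measurable_indic|exact: IH|exact: (aF n (mF n))].
  (* The constant 1 dominates, and it is integrable because [m] is finite. *)
  have [] := @dominated_convergence _ mR R m setT measurableT (fun n x => (\1_(U n) x)%:E)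
    (fun x => (\1_(\bigcup_k F k) x)%:E) (cst 1%E).
  + by move=> n; apply/measurable_EFinP; exact: measurable_indic.
  + by apply/measurable_EFinP; exact: measurable_indic.
  + apply: aeW => x _; have [[k _ Fkx]|nFx] := pselect ((\bigcup_k F k) x).
      apply: cvg_near_cst; exists k.+1 => // n /= kn.
      rewrite !indicE !mem_set//; first by exists k.
      by rewrite /U -bigcup_mkord; exists k.
    rewrite (_ : (fun _ => _) = cst 0%E).
      by rewrite indicE memNset//; exact: cvg_cst.
    apply/funext => n; rewrite indicE memNset// => Ux; apply: nFx.
    by move: Ux; rewrite /U -bigcup_mkord => -[k _ Fkx]; exists k.
  + apply: (measurable_bounded_integrable (f := cst (1 : R))) => //.
    by exists 1; split => // M M1 x _ /=; rewrite normr1 ltW.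
  + by apply: aeW => x n _; rewrite gee0_abs ?lee_fin// indicE; case: (_ \in _).
  move=> _ /fine_cvgP[fin /cvgrPdist_le/(_ _ e0) le_e] _.
  near \oo => n.
  exists \1_(U n); split; [exact: measurable_indic|exact: aU|].
  have fn : (\int[m]_x (`|\1_(\bigcup_k F k) x - \1_(U n) x|)%:E \is a fin_num)%E.
    under eq_integral do rewrite distrC; near: n; exact: fin.
  rewrite -(fineK fn) lee_fin; under eq_integral do rewrite distrC.
  have : `|0 - fine (\int[m]_x (`|\1_(U n) x - \1_(\bigcup_k F k) x|)%:E)| <= e.
    by near: n; exact: le_e.
  by rewrite sub0r normrN; apply: le_trans; exact: ler_norm.
- have := mA; rewrite -[X in X -> _]/(R.-ocitv.-measurable.-sigma.-measurable A).
  by rewrite RGenOInfty.measurableE.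
Unshelve. all: by end_near. Qed.

Import HBSimple.

(** A bounded function is integrable for the finite measure [m], hence an [L^1] limit of simple
    functions, and these are finite combinations of indicators. *)
Lemma step_approx_bounded (g : R -> R) M : measurable_fun (setT : set mR) g ->
  (forall x, `|g x| <= M) -> step_approx g.
Proof.
move=> mg gM.
have ig : m.-integrable setT (EFin \o g).
  apply: measurable_bounded_integrable => //.
  exists M; split; first exact: num_real.
  by move=> N MN x _ /=; exact: le_trans (gM _) (ltW MN).
have [g_ [ig_ _ /fine_cvgP[fin cvg0]]] := approximation_sfun_integrable measurableT ig.
apply: step_approx_lim => // e e0.
move/cvgrPdist_le : cvg0 => /(_ _ e0) le_e.
near \oo => n.
exists (g_ n); split => //.
- have gE : (g_ n : R -> R) =
      (fun x => \sum_(y <- fset_set (range (g_ n))) y * \1_(g_ n @^-1` [set y]) x).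
    by apply/funext => x; rewrite {1}fimfunE fsbig_finite.
  have H (r : seq R) :
      step_approx (fun x => \sum_(y <- r) y * \1_(g_ n @^-1` [set y]) x).
    elim: r => [|y r IH].
      by under eq_fun do rewrite big_nil; exact: (@step_approx_step [::]).
    have mi (z : R) : measurable_fun (setT : set mR) (fun x : R => z * \1_(g_ n @^-1` [set z]) x).
      by apply: measurable_funM => //; exact: measurable_indic.
    under eq_fun do rewrite big_cons; apply: step_approxD => //.
    + exact: measurable_sum.
    + by apply: step_approxZ; [exact: measurable_indic|exact: step_approx_indic].
  by rewrite gE.
- have fn : (\int[m]_x (`|g x - g_ n x|)%:E \is a fin_num)%E by near: n; exact: fin.
  rewrite -(fineK fn) lee_fin.
  have : `|0 - fine (\int[m]_x (`|g x - g_ n x|)%:E)| <= e by near: n; exact: le_e.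
  by rewrite sub0r normrN; apply: le_trans; exact: ler_norm.
Unshelve. all: by end_near. Qed.

End step_density.

(** * The Poisson distribution *)

Lemma measurable_fun_nat d (T : measurableType d) (f : T -> nat) :
  (forall k, measurable [set w | f w = k]) -> measurable_fun setT f.
Proof.
move=> mf _ B _; rewrite setTI.
have -> : f @^-1` B = \bigcup_(k in B) [set w | f w = k].
  by apply/seteqP; split => [w Bw|w [k Bk /= fk]]; [exists (f w)|rewrite /= fk].
exact: bigcup_measurable.
Qed.

(** The source space is cut along the countably many values of [K]. This gives the measurability of
    sums and products of random length [N t]. *)
Lemma measurable_fun_nat_index d d' (T : measurableType d) (U : measurableType d')
    (f : nat -> T -> U) (K : T -> nat) :
  (forall n, measurable_fun setT (f n)) -> measurable_fun setT K ->
  measurable_fun setT (fun w => f (K w) w).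
Proof.
move=> mf mK _ B mB; rewrite setTI.
have -> : (fun w => f (K w) w) @^-1` B = \bigcup_n (K @^-1` [set n] `&` f n @^-1` B).
  apply/seteqP; split => [w fB|w [n _ [/= -> //]]]; by exists (K w).
by apply: bigcupT_measurable => n; apply: measurableI; exact: measurable_preimage.
Qed.

(** It turns a difference of products over the points into a sum over the points, to which
    Campbell's formula applies. *)
Lemma ler_dist_prod (R : realDomainType) (I : Type) (r : seq I) (a b : I -> R) :
  (forall i, 0 <= a i <= 1) -> (forall i, 0 <= b i <= 1) ->
  `|\prod_(i <- r) a i - \prod_(i <- r) b i| <= \sum_(i <- r) `|a i - b i|.
Proof.
move=> a01 b01; elim: r => [|i r IH]; first by rewrite !big_nil subrr normr0.
rewrite !big_cons; set A := \prod_(j <- r) a j; set B := \prod_(j <- r) b j.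
have -> : a i * A - b i * B = (a i - b i) * A + b i * (A - B) by ring.
apply: le_trans (ler_normD _ _) _; rewrite !normrM lerD//.
  rewrite ler_piMr// ger0_norm; last by apply: prodr_ge0 => j _; have /andP[] := a01 j.
  by apply: prodr_ile1 => j _; exact: a01.
apply: le_trans IH; rewrite ler_piMl// ger0_norm; by have /andP[] := b01 i.
Qed.

Lemma expRN_lipschitz (R : realType) (a b : R) : 0 <= a -> 0 <= b ->
  `|expR (- a) - expR (- b)| <= `|a - b|.
Proof.
wlog ab : a b / a <= b.
  move=> H a0 b0; have [ab|/ltW ba] := leP a b; first exact: H.
  by rewrite distrC (distrC a); exact: H.
move=> a0 b0; rewrite ger0_norm ?subr_ge0 ?ler_expR ?lerN2//.
rewrite distrC ger0_norm ?subr_ge0//.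
have -> : - b = - a + - (b - a) by ring.
rewrite expRD -[X in X - _]mulr1 -mulrBr.
have h := expR_ge1Dx (- (b - a)).
have e0 := expR_ge0 (- a).
have e1 : expR (- a) <= 1 by rewrite expR_le1 lerNl oppr0.
apply: (@le_trans _ _ (1 - expR (- (b - a)))); last by lra.
by rewrite ler_piMl// subr_ge0 expR_le1 lerNl oppr0 subr_ge0.
Qed.

Lemma expR_nneseries (R : realType) (x : R) : 0 <= x ->
  (\sum_(k <oo) (x ^+ k / k`!%:R)%:E = (expR x)%:E)%E.
Proof.
move=> x0; rewrite -EFin_lim; last exact: is_cvg_series_exp_coeff.
by apply: congr_lim; apply/funext => n /=; rewrite /series/= -sumEFin.
Qed.

Section poisson_law.
Context {R : realType} d (Omega : measurableType d) (P : probability Omega R).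
Variables (Y : Omega -> nat) (a : R).
Hypotheses (a0 : 0 <= a) (mY : measurable_fun setT Y).
Hypothesis PY : forall k,
  fine (P [set w | Y w = k]) = expR (- a) * a ^+ k / (k`!)%:R.

Let mYk k : measurable [set w | Y w = k].
Proof. exact: (measurable_preimage (A := [set k]) mY). Qed.

Lemma poisson_integral (g : nat -> R) : (forall k, 0 <= g k) ->
  (\int[P]_w (g (Y w))%:E =
   \sum_(k <oo) (g k * (expR (- a) * a ^+ k / (k`!)%:R))%:E)%E.
Proof.
move=> g0.
have UY : \bigcup_k [set w | Y w = k] = setT.
  by apply/seteqP; split => // w _; exists (Y w).
rewrite -UY ge0_integral_bigcup//.
- apply: eq_eseriesr => k _.
  rewrite (eq_integral (fun=> (g k)%:E)); last by move=> w; rewrite inE => ->.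
  by rewrite integral_cst// EFinM -PY fineK// fin_num_measure.
- apply/measurable_EFinP; rewrite UY; exact: (measurableT_comp (f := g)).
- by move=> w _; rewrite lee_fin.
- by apply/trivIsetP => i j _ _ ij; apply/seteqP; split => // w [/= -> ji];
    rewrite ji eqxx in ij.
Qed.

Lemma poisson_pgf (z : R) : 0 <= z ->
  (\int[P]_w (z ^+ Y w)%:E = (expR (- (a * (1 - z))))%:E)%E.
Proof.
move=> z0; rewrite (poisson_integral (g := fun k => z ^+ k)); last first.
  by move=> k; exact: exprn_ge0.
have -> : - (a * (1 - z)) = - a + a * z by ring.
rewrite expRD EFinM -(expR_nneseries (x := a * z)) ?mulr_ge0// -nneseriesZl; last first.
  by move=> k _; rewrite lee_fin divr_ge0// exprn_ge0// mulr_ge0.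
by apply: eq_eseriesr => k _; rewrite -EFinM; congr EFin; rewrite exprMn; ring.
Qed.

Lemma poisson_mean : (\int[P]_w ((Y w)%:R)%:E = a%:E)%E.
Proof.
rewrite (poisson_integral (g := fun k => k%:R))//.
have g0 k : (0 <= (k%:R * (expR (- a) * a ^+ k / k`!%:R))%:E)%E.
  by rewrite lee_fin !mulr_ge0// ?expR_ge0// exprn_ge0.
(* The term of index 0 vanishes, and after a shift [(k + 1) / (k + 1)!] becomes [1 / k!]. *)
rewrite nneseries_recl// mul0r add0e -nneseries_addn//.
transitivity (\sum_(k <oo) ((a * expR (- a))%:E * (a ^+ k / k`!%:R)%:E))%E.
  apply: eq_eseriesr => k _; rewrite addn1 -EFinM; congr EFin.
  have kf : k`!%:R != 0 :> R by rewrite pnatr_eq0 -lt0n fact_gt0.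
  have k1 : k%:R + 1 != 0 :> R by rewrite natr1 pnatr_eq0.
  by rewrite factS natrM exprS -natr1; field; rewrite kf k1.
rewrite nneseriesZl; last by move=> k _; rewrite lee_fin divr_ge0// exprn_ge0.
by rewrite expR_nneseries// -EFinM -mulrA -expRD addNr expR0 mulr1.
Qed.

End poisson_law.

(** * The Poisson process *)

Section nhpp.
Context {R : realType} d (Omega : measurableType d) (P : probability Omega R).
Variables (lam : R -> R) (N : R -> Omega -> nat) (T : nat -> Omega -> R).
Hypothesis mlam : measurable_fun setT lam.
Hypothesis lam0 : forall x, 0 <= lam x.
Hypothesis ilam : forall x, 0 <= x ->
  lebesgue_measure.-integrable `[0%R, x]%classic (fun y => (lam y)%:E).
Hypothesis HN : nhpp P lam N T.
Local Notation mR := (measurableTypeR R).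

Let N0 w : N 0 w = 0%N. Proof. by move: HN => [_ []]. Qed.

Let Nmono w s t : 0 <= s <= t -> (N s w <= N t w)%N.
Proof. by move: HN => [_ [_ [+ _]]]; apply. Qed.

Let mT i : measurable_fun setT (T i).
Proof. by move: HN => [_ [_ [_ [_ [_ [+ _]]]]]]; apply. Qed.

Lemma point_le i t s w : (0 < i)%N -> 0 <= t -> (i <= N t w)%N -> 0 <= s ->
  (T i w <= s) = (i <= N s w)%N.
Proof.
move=> i0 t0 it s0; move: HN => [_ [_ [_ [_ [_ [_ H]]]]]].
by apply/idP/idP => /(H w i t s i0 t0 it s0).
Qed.

Lemma point_gt0 i t w : (0 < i)%N -> 0 <= t -> (i <= N t w)%N -> 0 < T i w.
Proof. by move=> i0 t0 it; rewrite ltNge (point_le i0 t0 it)// N0 -ltnNge. Qed.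

Lemma measurable_count t : 0 <= t -> measurable_fun setT (N t).
Proof.
by move=> t0; apply: measurable_fun_nat => k; move: HN => [+ _]; apply.
Qed.

Let mincr a b : 0 <= a -> a <= b -> measurable_fun setT (fun w => (N b w - N a w)%N).
Proof.
move=> a0 ab; apply: measurable_fun_nat => k.
have -> : [set w | (N b w - N a w)%N = k] =
    \bigcup_i ([set w | N a w = i] `&` [set w | N b w = (i + k)%N]).
  apply/seteqP; split => w /=.
    by move=> <-; exists (N a w) => //=; rewrite subnKC// Nmono// a0.
  by move=> [i _ [/= -> ->]]; rewrite addKn.
apply: bigcup_measurable => i _; apply: measurableI.
  exact: (measurable_preimage (A := [set i]) (measurable_count a0)).
exact: (measurable_preimage (A := [set (i + k)%N]) (measurable_count (le_trans a0 ab))).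
Qed.

Let LambdaE x : 0 <= x ->
  (\int[lebesgue_measure]_(y in `[0%R, x]%classic) (lam y)%:E = (Lambda lam x)%:E)%E.
Proof. by move=> x0; rewrite fineK// integrable_fin_num//; exact: ilam. Qed.

Lemma Lambda0 : Lambda lam 0 = 0.
Proof. by rewrite /Lambda set_itv1 integral_set1. Qed.

Lemma Lambda_itv a b : 0 <= a -> a <= b ->
  (\int[lebesgue_measure]_(y in `]a, b]%classic) (lam y)%:E =
   (Lambda lam b - Lambda lam a)%:E)%E.
Proof.
move=> a0 ab.
have U : `[0, b]%classic = `[0, a]%classic `|` `]a, b]%classic :> set R.
  apply/seteqP; split => x /=; rewrite !in_itv/=.
    by move=> /andP[-> ->]; rewrite !andbT; case: leP; [left|right].
  move=> [/andP[-> xa]|/andP[ax ->]]; first exact: le_trans ab.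
  by rewrite andbT ltW// (le_lt_trans a0).
have := LambdaE (le_trans a0 ab); rewrite U ge0_integral_setU//=.
- by rewrite LambdaE// EFinB => <-; rewrite addeAC subee ?add0e.
- by apply/measurable_EFinP; exact: measurable_funTS.
- by move=> x _; rewrite lee_fin.
- apply/disj_setPS => x [] /=; rewrite !in_itv/= => /andP[_ xa] /andP[ax _].
  by rewrite ltNge xa in ax.
Qed.

Lemma Lambda_le a b : 0 <= a -> a <= b -> Lambda lam a <= Lambda lam b.
Proof.
move=> a0 ab; rewrite -subr_ge0 -lee_fin -Lambda_itv//.
by apply: integral_ge0 => x _; rewrite lee_fin.
Qed.

Let incr_law a b : 0 <= a -> a <= b -> forall k,
  fine (P [set w | (N b w - N a w)%N = k]) =
  expR (- (Lambda lam b - Lambda lam a)) * (Lambda lam b - Lambda lam a) ^+ k / (k`!)%:R.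
Proof.
by move=> a0 ab k; move: HN => [_ [_ [_ [+ _]]]]; apply; rewrite a0.
Qed.

Lemma incr_pgf a b z : 0 <= a -> a <= b -> 0 <= z ->
  (\int[P]_w (z ^+ (N b w - N a w))%:E =
   (expR (- ((Lambda lam b - Lambda lam a) * (1 - z))))%:E)%E.
Proof.
move=> a0 ab z0; apply: (poisson_pgf _ (mincr a0 ab) (incr_law a0 ab)) => //.
by rewrite subr_ge0 Lambda_le.
Qed.

Lemma incr_mean a b : 0 <= a -> a <= b ->
  (\int[P]_w ((N b w - N a w)%:R)%:E = (Lambda lam b - Lambda lam a)%:E)%E.
Proof.
move=> a0 ab; apply: (poisson_mean _ (mincr a0 ab) (incr_law a0 ab)) => //.
by rewrite subr_ge0 Lambda_le.
Qed.

(** * Campbell's formula and the probability generating functional of the points up to time [t] *)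

Section campbell.
Variable t : R.
Hypothesis t0 : 0 <= t.

Definition rate_on x := lam x * \1_`[0%R, t]%classic x.

Lemma measurable_rate_on : measurable_fun (setT : set mR) rate_on.
Proof.
by apply: measurable_funM => //; apply: measurable_indic; exact: measurable_itv.
Qed.

Lemma rate_on_ge0 x : 0 <= rate_on x.
Proof. by rewrite mulr_ge0. Qed.

Definition intensity : {measure set mR -> \bar R} :=
  wlaw_measure (lebesgue_measure : {measure set mR -> \bar R})
    measurable_rate_on rate_on_ge0 (@measurable_id _ mR setT).

Lemma integral_intensity (g : R -> \bar R) :
  measurable_fun (setT : set mR) g -> (forall x, 0 <= g x)%E ->
  (\int[intensity]_x g x =
   \int[lebesgue_measure]_(x in `[0%R, t]%classic) (g x * (lam x)%:E))%E.
Proof.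
move=> mg g0; rewrite integral_wlaw// [RHS]integral_mkcond.
apply: eq_integral => x _; rewrite patchE /rate_on indicE.
by case: (_ \in _); rewrite ?mulr1// mulr0 mule0.
Qed.

(** Index [i] belongs to the point [T i.+1]; the condition [i < N t w] says that this point exists
    and is at most [t]. *)
Let cnt (i : nat) (w : Omega) : R := (i < N t w)%N%:R.

Let mcnt i : measurable_fun setT (cnt i).
Proof.
rewrite (_ : cnt i = \1_[set w | (i < N t w)%N]).
  apply: measurable_indic.
  exact: (measurable_preimage (A := [set k | (i < k)%N]) (measurable_count t0)).
by apply/funext => w; rewrite indicE /cnt mem_setE.
Qed.

Let cnt0 i w : 0 <= cnt i w. Proof. by []. Qed.

(** The mean measure of the point process on [[0, t]]: the expected number of points in a set.
    Written as a series of weighted laws, one for each point, it is a measure by construction. *)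
Let mean : {measure set mR -> \bar R} :=
  mseries (fun i => @wlaw_measure _ _ _ mR _ P _ _ (mcnt i) (cnt0 i) (mT i.+1)) 0.

Let integral_mean (g : R -> R) : measurable_fun (setT : set mR) g ->
  (forall x, 0 <= g x) ->
  (\int[mean]_x (g x)%:E =
   \int[P]_w (\sum_(1 <= i < (N t w).+1) g (T i w))%:E)%E.
Proof.
move=> mg g0; rewrite ge0_integral_measure_series//; last 2 first.
- by move=> x _; rewrite lee_fin.
- exact/measurable_EFinP.
under eq_eseriesr.
  move=> i _; rewrite integral_wlaw//; last exact/measurable_EFinP.
  over.
rewrite -integral_nneseries//; last 2 first.
- move=> i; apply: emeasurable_funM; last exact/measurable_EFinP.
  apply/measurable_EFinP; exact: (measurableT_comp mg (mT i.+1)).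
- by move=> i w _; rewrite mule_ge0 ?lee_fin.
apply: eq_integral => w _.
rewrite (nneseries_split _ (N t w)); last first.
  by move=> k _; rewrite mule_ge0 ?lee_fin.
rewrite add0n eseries0 ?adde0; last first.
  by move=> i iN _; rewrite /cnt ltnNge iN mule0.
rewrite big_add1/= -sumEFin; apply: eq_big_nat => i /andP[_ iN].
by rewrite /cnt iN mule1.
Qed.

Let meanE A : measurable A -> mean A =
   (\int[P]_w (\sum_(1 <= i < (N t w).+1) \1_A (T i w))%:E)%E.
Proof.
move=> mA; rewrite -integral_mean; last 2 first.
- exact: measurable_indic.
- by [].
by rewrite integral_indic// setIT.
Qed.

(** The points in []b, +oo[] up to time [t] number [N t - N c], where [c] is [b] clamped to
    [[0, t]], and the mean of a Poisson increment is known. *)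
Let mean_ray b : mean `]b, +oo[%classic =
  (Lambda lam t - Lambda lam (Num.min t (Num.max 0 b)))%:E.
Proof.
set c := Num.min _ _.
have c0 : 0 <= c by rewrite le_min t0 le_max lexx.
have ct : c <= t by rewrite ge_min lexx.
rewrite meanE; last exact: measurable_itv.
rewrite -incr_mean//; apply: eq_integral => w _; congr EFin.
have Nct : (N c w <= N t w)%N by rewrite Nmono// c0.
rewrite (@big_cat_nat _ _ _ (N c w).+1)//=.
have Tb i : (0 < i <= N t w)%N -> (b < T i w) = (N c w < i)%N.
  move=> /andP[i0 it]; rewrite ltnNge -(point_le i0 t0 it)// -ltNge.
  have Tt : T i w <= t by rewrite (point_le i0 t0 it).
  have T0 := point_gt0 i0 t0 it.
  by rewrite /c gt_min gt_max T0/= ltNge Tt.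
rewrite big_nat_cond big1 ?add0r; last first.
  move=> i /andP[/andP[i0 ic] _]; rewrite indicE memNset//= in_itv/= andbT.
  by rewrite Tb ?i0 ?(leq_trans _ Nct)// ltnNge -ltnS ic.
rewrite (eq_big_nat _ _ (F2 := fun=> 1)); last first.
  move=> i /andP[ci it]; rewrite indicE mem_set//= in_itv/= andbT.
  by rewrite Tb ?ci// (leq_ltn_trans _ ci).
by rewrite sumr_const_nat subSS.
Qed.

(** Both sides integrate [g] against a measure, [mean] and [intensity], so it suffices to compare
    these on half-lines. The total mass of [mean] is finite, being the expectation of [N t]. *)
Lemma campbell (g : R -> R) : measurable_fun (setT : set mR) g ->
  (forall x, 0 <= g x) ->
  (\int[P]_w (\sum_(1 <= i < (N t w).+1) g (T i w))%:E = \int[intensity]_x (g x)%:E)%E.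
Proof.
move=> mg g0; rewrite -integral_mean//.
apply: eq_measure_integral => A mA _; apply: measure_rays_unique => //; last first.
  rewrite meanE//.
  under eq_integral => w _ do rewrite indicT sumr_const_nat subn1/= -(subn0 (N t w)) -(N0 w).
  by rewrite incr_mean// ltry.
move=> b; rewrite mean_ray.
transitivity (\int[lebesgue_measure]_(x in `]b, +oo[%classic `&` `[0%R, t]%classic) (lam x)%:E)%E; last first.
  rewrite integral_mkcondr; apply: eq_integral => x _.
  by rewrite patchE /rate_on indicE; case: (_ \in _); rewrite ?mulr1 ?mulr0.
have [b0|b0] := ltP b 0.
  rewrite (min_idPr _)// Lambda0 subr0.
  rewrite (_ : _ `&` _ = `[0, t]%classic) ?LambdaE//.
  by apply: setIidr => x /=; rewrite !in_itv/= andbT => /andP[x0 _]; exact: lt_le_trans x0.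
rewrite -Lambda_itv ?le_min ?t0// ?ge_min ?lexx//; congr integral.
apply/seteqP; split => x /=; rewrite !in_itv/= andbT gt_min.
  by move=> /andP[/orP[tx|bx] xt]; [rewrite ltNge xt in tx|rewrite bx (le_trans b0 (ltW bx))].
by move=> [bx /andP[_ xt]]; rewrite bx orbT.
Qed.

Lemma intensity_lty : (intensity setT < +oo)%E.
Proof.
have -> : intensity setT = (\int[intensity]_x 1)%E by rewrite integral_cst// mul1e.
rewrite integral_intensity//; under eq_integral do rewrite mul1e.
by rewrite LambdaE// ltry.
Qed.

Let measF a b i : 0 <= a -> a <= b -> sigma_incr N a b i -> measurable i.
Proof.
move=> a0 ab; apply: smallest_sub; first exact: sigma_algebra_measurable.
move=> A [k ->]; exact: (measurable_preimage (A := [set k]) (mincr a0 ab)).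
Qed.

Let sigma_incr_preimage a b (f : nat -> R) (B : set R) :
  sigma_incr N a b ((fun w => f (N b w - N a w)%N) @^-1` B).
Proof.
pose G := [set A | exists k, A = [set w | (N b w - N a w)%N = k]].
have mf : measurable_fun (setT : set (g_sigma_algebraType G)) (fun w => (N b w - N a w)%N).
  by apply: measurable_fun_nat => k; apply: sub_sigma_algebra; exists k.
exact: (measurable_preimage (A := f @^-1` B) mf).
Qed.

(** * The generating functional of a function that is constant on each interval of a partition *)

Section partition.
Variables (n : nat) (tt : nat -> R) (h : R -> R).
Hypotheses (tt0 : tt 0%N = 0) (ttS : forall k, tt k <= tt k.+1) (ttn : tt n = t).
Hypotheses (mh : measurable_fun (setT : set mR) h) (h01 : forall x, 0 <= h x <= 1).
Hypothesis h_step : forall k x, (k < n)%N -> tt k < x <= tt k.+1 -> h x = h (tt k.+1).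

Let tt_ge0 k : 0 <= tt k.
Proof. by elim: k => [|k IH]; [rewrite tt0|exact: le_trans (ttS k)]. Qed.

Let prod_points w m : (m <= n)%N ->
  \prod_(1 <= i < (N (tt m) w).+1) h (T i w) =
  \prod_(k < m) h (tt k.+1) ^+ (N (tt k.+1) w - N (tt k) w).
Proof.
elim: m => [_|m IH mn]; first by rewrite tt0 N0 big_ord0 big_nil.
rewrite big_ord_recr/= -IH; last exact: ltnW.
have Nm : (N (tt m) w <= N (tt m.+1) w)%N by rewrite Nmono// tt_ge0 ttS.
rewrite (@big_cat_nat _ _ _ (N (tt m) w).+1)//=; congr (_ * _).
(* A point whose index exceeds [N (tt m) w] and is at most [N (tt m.+1) w] lies in []tt m, tt
   m.+1]], where [h] is constant. *)
rewrite (eq_big_nat _ _ (F2 := fun=> h (tt m.+1))); last first.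
  move=> i /andP[mi im]; apply: h_step => //.
  have i0 : (0 < i)%N by exact: leq_ltn_trans mi.
  by rewrite ltNge !(point_le i0 (tt_ge0 m.+1))// -ltnNge mi -ltnS im.
by rewrite prodr_const_nat subSS.
Qed.

Let integral_step m : (m <= n)%N ->
  (\int[lebesgue_measure]_(x in `[0%R, tt m]%classic) ((1 - h x)%:E * (lam x)%:E) =
  (\sum_(k < m) (Lambda lam (tt k.+1) - Lambda lam (tt k)) * (1 - h (tt k.+1)))%:E)%E.
Proof.
have mhl (A : set mR) : measurable_fun A (fun x => (1 - h x)%:E * (lam x)%:E)%E.
  apply: measurable_funTS; apply: emeasurable_funM; apply/measurable_EFinP => //.
  exact: measurable_funB.
elim: m => [_|m IH mn].
  by rewrite tt0 set_itv1 integral_set1 big_ord0.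
have U : `[0, tt m.+1]%classic = `[0, tt m]%classic `|` `]tt m, tt m.+1]%classic :> set R.
  apply/seteqP; split => x /=; rewrite !in_itv/=.
    by move=> /andP[-> ->]; rewrite !andbT; case: leP; [left|right].
  move=> [/andP[-> xa]|/andP[ax ->]]; first exact: le_trans (ttS m).
  by rewrite andbT ltW// (le_lt_trans (tt_ge0 m)).
rewrite U ge0_integral_setU//=.
- rewrite IH ?(ltnW mn)// big_ord_recr/= EFinD; congr (_ + _)%E.
  rewrite (eq_integral (fun x : mR => (1 - h (tt m.+1))%:E * (lam x)%:E)%E); last first.
    by move=> x; rewrite inE/= in_itv/= => xm; rewrite (h_step mn xm).
  rewrite ge0_integralZl//.
  + by rewrite Lambda_itv// -EFinM mulrC.
  + by apply/measurable_EFinP; exact: measurable_funTS.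
  + by move=> x _; rewrite lee_fin.
  + by rewrite lee_fin subr_ge0; have /andP[] := h01 (tt m.+1).
- move=> x _; rewrite mule_ge0 ?lee_fin// subr_ge0; by have /andP[] := h01 x.
- apply/disj_setPS => x [] /=; rewrite !in_itv/= => /andP[_ xa] /andP[ax _].
  by rewrite ltNge xa in ax.
Qed.

Lemma pgfl_partition :
  (\int[P]_w (\prod_(1 <= i < (N t w).+1) h (T i w))%:E =
   (expR (- fine (\int[intensity]_x (1 - h x)%:E)))%:E)%E.
Proof.
rewrite -{1}ttn; under eq_integral do rewrite prod_points//.
have indepN : indep P (fun k : 'I_n => sigma_incr N (tt k) (tt k.+1)).
  by move: HN => [_ [_ [_ [_ [+ _]]]]]; apply => //; rewrite tt0.
have mFk (k : 'I_n) : sigma_incr N (tt k) (tt k.+1) `<=` measurable.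
  by move=> A; exact: measF.
rewrite (integral_prod_indep indepN mFk
    (f := fun k w => h (tt k.+1) ^+ (N (tt k.+1) w - N (tt k) w)%N)).
- have h0 x : 0 <= h x by have /andP[] := h01 x.
  under eq_bigr => k _ do rewrite (incr_pgf (tt_ge0 k) (ttS k) (h0 _))/=.
  rewrite integral_intensity; last 2 first.
  + by apply/measurable_EFinP; exact: measurable_funB.
  + by move=> x; rewrite lee_fin subr_ge0; have /andP[] := h01 x.
  by rewrite -ttn integral_step//= -expR_sum -sumrN.
- exact: index_enum_uniq.
- move=> k w; have /andP[h0 h1] := h01 (tt k.+1).
  by rewrite exprn_ge0//= exprn_ile1.
- move=> k _; apply: (measurableT_comp (f := fun j : nat => h (tt k.+1) ^+ j)) => //.
  exact: mincr.
- by move=> k B _ _; exact: sigma_incr_preimage.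
Qed.

End partition.

Lemma pgfl_step (s : seq R) (h : R -> R) : step_fun s h ->
  measurable_fun (setT : set mR) h -> (forall x, 0 <= h x <= 1) ->
  (\int[P]_w (\prod_(1 <= i < (N t w).+1) h (T i w))%:E =
   (expR (- fine (\int[intensity]_x (1 - h x)%:E)))%:E)%E.
Proof.
move=> sh mh h01.
pose clamp (a : R) := Num.min t (Num.max 0 a).
(* Thresholds outside [[0, t]] are moved to an endpoint; the repetitions that result only create
   empty intervals. *)
pose u := 0 :: sort <=%R (map clamp s).
have ut : all (<= t) u.
  rewrite /u/= t0/= all_sort; apply/allP => _ /mapP[a _ ->].
  by rewrite /= /clamp ge_min lexx.
have us : sorted <=%R u.
  rewrite /u/= path_sortedE; last exact: le_trans.
  rewrite sort_sorted ?andbT; last exact: le_total.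
  rewrite all_sort; apply/allP => _ /mapP[a _ ->].
  by rewrite /= /clamp le_min t0 le_max lexx.
(* The default value [t] closes the partition: [tt] equals [t] from index [size u] on. *)
pose tt := nth t u.
have ttle i j : (i <= j)%N -> tt i <= tt j.
  move=> ij; have [ju|uj] := ltnP j (size u).
    by apply: (sorted_leq_nth le_trans le_refl) => //; rewrite inE// (leq_ltn_trans ij).
  rewrite /tt (nth_default _ uj); have [iu|ui] := ltnP i (size u).
    by apply: (allP ut); exact: mem_nth.
  by rewrite nth_default.
apply: (@pgfl_partition (size u) tt) => //.
- by move=> k; apply: ttle.
- by rewrite /tt nth_default.
- move=> k x ku /andP[kx xk]; apply: sh => a as_.
  have x0 : 0 < x by apply: le_lt_trans kx; rewrite -[leLHS]/(tt 0%N) ttle.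
  have xt : x <= t.
    by apply: le_trans xk _; rewrite -(nth_default t (leqnn (size u))) -/tt ttle.
  (* If [x <= a], then the clamped [a] is some [tt j] with [tt j >= x > tt k]. So [j > k], and
     [tt k.+1 <= tt j <= a]: no threshold separates [x] from the right end of its interval. *)
  apply/idP/idP => [xa|]; last exact: le_trans.
  have cu : clamp a \in u by rewrite in_cons mem_sort map_f ?orbT.
  have xc : x <= clamp a by rewrite /clamp le_min xt le_max xa orbT.
  apply: (@le_trans _ _ (clamp a)).
    rewrite -(nth_index t cu) -/tt ttle// ltnNge; apply/negP => jk.
    by have := lt_le_trans kx xc; rewrite -(nth_index t cu) ltNge ttle.
  by rewrite /clamp ge_min ge_max (ltW (lt_le_trans x0 xa)) lexx orbT.
Qed.

Let measurable_prod_points (h : R -> R) : measurable_fun (setT : set mR) h ->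
  measurable_fun setT (fun w => \prod_(1 <= i < (N t w).+1) h (T i w)).
Proof.
move=> mh.
apply: (@measurable_fun_nat_index _ _ _ _
  (fun n w => \prod_(1 <= i < n.+1) h (T i w)) (N t)); last exact: measurable_count.
by move=> n; apply: measurable_prod => i _; exact: (measurableT_comp mh (mT i)).
Qed.

Let prod_points01 (h : R -> R) w : (forall x, 0 <= h x <= 1) ->
  0 <= \prod_(1 <= i < (N t w).+1) h (T i w) <= 1.
Proof.
move=> h01; rewrite prodr_ile1 ?andbT => [|i _]; last exact: h01.
by apply: prodr_ge0 => i _; have /andP[] := h01 (T i w).
Qed.

Let pgfl_dist (g h : R -> R) e :
  measurable_fun (setT : set mR) g -> measurable_fun (setT : set mR) h ->
  (forall x, 0 <= g x <= 1) -> (forall x, 0 <= h x <= 1) ->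
  (\int[intensity]_x (`|g x - h x|)%:E <= e%:E)%E ->
  `|Rintegral P setT (fun w => \prod_(1 <= i < (N t w).+1) g (T i w)) -
    Rintegral P setT (fun w => \prod_(1 <= i < (N t w).+1) h (T i w))| <= e.
Proof.
move=> mg mh g01 h01 gh.
have i1 (k : R -> R) : measurable_fun (setT : set mR) k -> (forall x, 0 <= k x <= 1) ->
    P.-integrable setT (EFin \o (fun w => \prod_(1 <= i < (N t w).+1) k (T i w))).
  move=> mk k01; apply: (@bounded_measurable_integrable _ _ _ _ _ _ 1) => //.
  - by apply: le_lt_trans (probability_le1 P measurableT) _; rewrite ltry.
  - exact: measurable_prod_points.
  - by move=> w _; have /andP[k0 k1] := prod_points01 w k01; rewrite ger0_norm.
rewrite -RintegralB//; [|exact: i1|exact: i1].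
have i3 : P.-integrable setT (EFin \o (fun w => \prod_(1 <= i < (N t w).+1) g (T i w) -
    \prod_(1 <= i < (N t w).+1) h (T i w))).
  by exact: (integrableB measurableT (i1 _ mg g01) (i1 _ mh h01)).
rewrite -lee_fin EFin_normr_Rintegral//.
apply: le_trans (le_abse_integral _ _ _) _ => //.
  by case/integrableP : i3.
apply: le_trans gh; rewrite -campbell//; last first.
  by apply: measurableT_comp => //; exact: measurable_funB.
apply: ge0_le_integral => //.
- by apply: measurableT_comp => //; case/integrableP : i3.
- apply/measurable_EFinP.
  apply: (@measurable_fun_nat_index _ _ _ _
    (fun n w => \sum_(1 <= i < n.+1) `|g (T i w) - h (T i w)|) (N t));
    last exact: measurable_count.
  move=> n; apply: measurable_sum => i; apply: measurableT_comp => //.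
  by apply: measurable_funB; [exact: (measurableT_comp mg (mT i))
                             |exact: (measurableT_comp mh (mT i))].
- by move=> w _; rewrite lee_fin; exact: ler_dist_prod.
Qed.

Lemma pgfl (g : R -> R) :
  measurable_fun (setT : set mR) g -> (forall x, 0 <= g x <= 1) ->
  (\int[P]_w (\prod_(1 <= i < (N t w).+1) g (T i w))%:E =
   (expR (- fine (\int[intensity]_x (1 - g x)%:E)))%:E)%E.
Proof.
move=> mg g01.
rewrite -[LHS]fineK; last first.
  by apply: integral01_fin_num; [exact: measurable_prod_points|move=> w; exact: prod_points01].
congr EFin; apply/eqP; rewrite -subr_eq0 -normr_le0; apply/ler_addgt0Pr => e e0.
rewrite add0r.
have e20 : 0 < e / 2 by rewrite divr_gt0.
have gle1 x : `|g x| <= 1 by have /andP[? ?] := g01 x; rewrite ger0_norm.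
have [h0 [s [sh0 mh0 gh0]]] := step_approx_bounded intensity_lty mg gle1 e20.
(* Clamping keeps a step function and cannot increase the distance to [g], whose values lie in
   [[0, 1]]. *)
pose h x := Num.min 1 (Num.max 0 (h0 x)).
have h01 x : 0 <= h x <= 1 by rewrite le_min ler01 le_max lexx ge_min lexx.
have mh : measurable_fun (setT : set mR) h.
  by apply: measurable_minr => //; exact: measurable_maxr.
have sh : step_fun s h by move=> x y xy; rewrite /h (sh0 x y).
have gh : (\int[intensity]_x (`|g x - h x|)%:E <= (e / 2)%:E)%E.
  apply: le_trans gh0; apply: ge0_le_integral => //.
  - by apply/measurable_EFinP/measurableT_comp => //; exact: measurable_funB.
  - by apply/measurable_EFinP/measurableT_comp => //; exact: measurable_funB.
  - move=> x _; rewrite lee_fin /h; have /andP[g0 g1] := g01 x.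
    have gh1 := ler_norm (g x - h0 x); have gh2 := ler_norm (h0 x - g x).
    rewrite distrC in gh2; move: gh1 gh2; move: `|g x - h0 x| => c gh1 gh2.
    rewrite /Num.min /Num.max ler_norml.
    by apply/andP; split; do ! case: ifPn; rewrite -?leNgt; lra.
have Phi := pgfl_dist mg mh g01 h01 gh.
have hE := pgfl_step sh mh h01.
have ione (k : R -> R) : measurable_fun (setT : set mR) k -> (forall x, 0 <= k x <= 1) ->
    intensity.-integrable setT (EFin \o (fun x => 1 - k x)).
  move=> mk k01; apply: (@bounded_measurable_integrable _ _ _ _ _ _ 1) => //.
  - exact: intensity_lty.
  - exact: measurable_funB.
  - by move=> x _; have /andP[k0 k1] := k01 x; rewrite ger0_norm ?subr_ge0// lerBlDr lerDl.
have ige0 (k : R -> R) : (forall x, 0 <= k x <= 1) ->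
    0 <= Rintegral intensity setT (fun x => 1 - k x).
  by move=> k01; apply: Rintegral_ge0 => x _; rewrite subr_ge0; have /andP[] := k01 x.
have Psi : `|expR (- Rintegral intensity setT (fun x => 1 - h x)) -
             expR (- Rintegral intensity setT (fun x => 1 - g x))| <= e / 2.
  apply: le_trans (expRN_lipschitz (ige0 _ h01) (ige0 _ g01)) _.
  rewrite -RintegralB//; [|exact: ione|exact: ione].
  have ihg := integrableB measurableT (ione _ mh h01) (ione _ mg g01).
  rewrite -lee_fin EFin_normr_Rintegral//.
  apply: le_trans (le_abse_integral _ _ _) _ => //; first by case/integrableP : ihg.
  apply: le_trans gh; rewrite le_eqVlt; apply/orP; left; apply/eqP.
  by apply: eq_integral => x _ /=; congr (`|_|%:E); ring.
rewrite [e]splitr.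
set a := fine _; set b := expR _.
set c := Rintegral P setT (fun w => \prod_(1 <= i < (N t w).+1) h (T i w)) in Phi.
have -> : a - b = (a - c) + (c - b) by ring.
apply: le_trans (ler_normD _ _) _; apply: lerD => //.
by rewrite /c /Rintegral hE.
Qed.

End campbell.
End nhpp.

(** * Integrating out independent marks *)

Lemma measurable_fun_g_sigma_algebra d d' (T : measurableType d) (U : measurableType d')
    (G : set (set T)) (f : T -> U) : G `<=` measurable ->
  measurable_fun (setT : set (g_sigma_algebraType G)) f -> measurable_fun setT f.
Proof.
move=> mG mf _ B mB; rewrite setTI.
have := measurable_preimage mf mB; apply: smallest_sub => //.
exact: sigma_algebra_measurable.
Qed.

Lemma wlawE d1 d2 (T1 : measurableType d1) (T2 : measurableType d2) (R : realType)
    (mu : {measure set T1 -> \bar R}) (W : T1 -> R) (X : T1 -> T2) (A : set T2) :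
  wlaw mu W X A = (\int[mu]_w (W w * \1_A (X w))%:E)%E.
Proof.
rewrite /wlaw integral_mkcond; apply: eq_integral => w _; rewrite patchE indicE.
have [wA|wA] := boolP (w \in X @^-1` A).
  by move: wA; rewrite inE /= => wA; rewrite mem_set// mulr1.
by rewrite memNset ?mulr0// => XA; move: wA; rewrite notin_setE.
Qed.

Lemma indic_setX (T1 T2 : Type) (R : pzRingType) (A : set T1) (B : set T2) x y :
  \1_(A `*` B) (x, y) = \1_A x * \1_B y :> R.
Proof. by rewrite !indicE in_setX/=; case: (_ \in A); case: (_ \in B); rewrite ?mulr1 ?mulr0. Qed.

Lemma measure_rectangles_unique d1 d2 (T1 : measurableType d1) (T2 : measurableType d2)
    (R : realType) (m1 m2 : {measure set (T1 * T2)%type -> \bar R}) :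
  (forall A B, measurable A -> measurable B -> m1 (A `*` B) = m2 (A `*` B)) ->
  (m1 setT < +oo)%E -> forall C, measurable C -> m1 C = m2 C.
Proof.
move=> m12 m1oo C mC.
pose G : set (set (T1 * T2)) :=
  [set C | exists A, measurable A /\ exists B, measurable B /\ C = A `*` B].
apply: (measure_unique G (fun=> setT)) => //.
- rewrite measurable_prod_measurableType; congr (<<s _ >>).
  rewrite predeqE => S; split => [[A mA [B mB <-]]|[A [mA [B [mB ->]]]]].
    by exists A; split => //; exists B.
  by exists A => //; exists B.
- move=> _ _ [A [mA [B [mB ->]]]] [A' [mA' [B' [mB' ->]]]]; rewrite -setXI.
  by exists (A `&` A'); split; [exact: measurableI|exists (B `&` B'); split => //; exact: measurableI].
- by move=> _; exists setT; split => //; exists setT; split => //; rewrite setXTT.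
- by rewrite bigcup_const//; exists 0%N.
- by move=> _ [A [mA [B [mB ->]]]]; exact: m12.
Qed.

Section marks.
Context {R : realType} d d' (Omega : measurableType d) (U : measurableType d').
Variables (P : probability Omega R) (mu : probability U R).
Variables (G : set (set Omega)) (X : nat -> Omega -> R) (V : nat -> Omega -> U).
Variable g : nat -> R * U -> R.
Local Notation mG := (g_sigma_algebraType G).
Hypothesis Gm : G `<=` measurable.
Hypothesis mV : forall i, measurable_fun setT (V i).
Hypothesis mX : forall i, measurable_fun (setT : set mG) (X i).
Hypothesis mg : forall i, measurable_fun setT (g i).
Hypothesis g01 : forall i x, 0 <= g i x <= 1.
Hypothesis indepV : forall (Y : Omega -> R) (B : nat -> set U) n,
  measurable_fun (setT : set mG) Y -> (forall w, 0 <= Y w <= 1) ->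
  (forall i, measurable (B i)) ->
  (\int[P]_w (Y w * \prod_(0 <= i < n) \1_(B i) (V i w))%:E =
   \int[P]_w (Y w)%:E * (\prod_(0 <= i < n) fine (mu (B i)))%:E)%E.

Definition mark_mean i x : R := fine (\int[mu]_v (g i (x, v))%:E)%E.

Let mXO i : measurable_fun setT (X i).
Proof. exact: measurable_fun_g_sigma_algebra (mX i). Qed.

Let mgx i x : measurable_fun setT (fun v => g i (x, v)).
Proof. by apply: measurableT_comp => //; exact: pair1_measurable. Qed.

Let mark_meanE i x : (\int[mu]_v (g i (x, v))%:E)%E = (mark_mean i x)%:E.
Proof. by rewrite fineK// integral01_fin_num. Qed.

Lemma mark_mean01 i x : 0 <= mark_mean i x <= 1.
Proof.
rewrite -!lee_fin -mark_meanE integral01_le1// andbT.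
by apply: integral_ge0 => v _; rewrite lee_fin; have /andP[] := g01 i (x, v).
Qed.

Lemma measurable_mark_mean i : measurable_fun setT (mark_mean i).
Proof.
have -> : mark_mean i = fine \o (fun x => \int[mu]_v (g i (x, v))%:E)%E by [].
apply: measurableT_comp => //.
apply: (measurable_fun_fubini_tonelli_F (m2 := mu) (fun z => (g i z)%:E)).
  exact/measurable_EFinP.
by move=> z; rewrite lee_fin; have /andP[] := g01 i z.
Qed.

Let mmeanX i : measurable_fun (setT : set mG) (fun w => mark_mean i (X i w)).
Proof. exact: (measurableT_comp (measurable_mark_mean i) (mX i)). Qed.

Let prod01 (I : Type) (r : seq I) (F : I -> R) : (forall i, 0 <= F i <= 1) ->
  0 <= \prod_(i <- r) F i <= 1.
Proof.
move=> F01; rewrite prodr_ile1 ?andbT => [|i _]; last exact: F01.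
by apply: prodr_ge0 => i _; have /andP[] := F01 i.
Qed.

Let mul01 (a b : R) : 0 <= a <= 1 -> 0 <= b <= 1 -> 0 <= a * b <= 1.
Proof. by move=> /andP[a0 a1] /andP[b0 b1]; rewrite mulr_ge0//= mulr_ile1. Qed.

Let ind01 (T : Type) (B : set T) x : 0 <= (\1_B x : R) <= 1.
Proof. by rewrite indicE; case: (_ \in _); rewrite lexx ler01. Qed.

(** The weight [Y] and the marks still tested on events are what the induction on [k] needs.
    Weighted by the other factors, [(X k, V k)] has the same law as [(X k, v)] with a fresh [v] of
    law [mu]. On rectangles this is the induction hypothesis, with the event on [X k] absorbed in
    [Y] and the event on [V k] taken from the tested marks. Integrating [g k] against this law,
    Tonelli's theorem produces [mark_mean k]. *)
Lemma integral_marks_indic n k (Y : Omega -> R) (B : nat -> set U) : (k <= n)%N ->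
  measurable_fun (setT : set mG) Y -> (forall w, 0 <= Y w <= 1) ->
  (forall i, measurable (B i)) ->
  (\int[P]_w (Y w * \prod_(0 <= i < k) g i (X i w, V i w) *
              \prod_(k <= i < n) \1_(B i) (V i w))%:E =
   \int[P]_w (Y w * \prod_(0 <= i < k) mark_mean i (X i w))%:E *
   (\prod_(k <= i < n) fine (mu (B i)))%:E)%E.
Proof.
elim: k Y B => [|k IH] Y B kn mY Y01 mB.
  under eq_integral do rewrite big_geq// mulr1.
  under [X in (_ = X * _)%E]eq_integral do rewrite big_geq// mulr1.
  exact: indepV.
have {}IH Y' B' := IH Y' B' (ltnW kn).
have mYO := measurable_fun_g_sigma_algebra Gm mY.
pose W w := Y w * \prod_(0 <= i < k) g i (X i w, V i w) *
  \prod_(k.+1 <= i < n) \1_(B i) (V i w).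
have W01 w : 0 <= W w <= 1 by rewrite !mul01// prod01.
have W0 w : 0 <= W w by have /andP[] := W01 w.
have mXV i : measurable_fun setT (fun w => (X i w, V i w)) by exact: measurable_fun_pair.
have mW : measurable_fun setT W.
  apply: measurable_funM; first apply: measurable_funM => //.
    by apply: measurable_prod => i _; exact: measurableT_comp.
  by apply: measurable_prod => i _; apply: measurableT_comp => //; exact: measurable_indic.
pose Bk (C : set U) i := if i == k then C else B i.
have mBk C i : measurable C -> measurable (Bk C i) by rewrite /Bk; case: ifP.
have prodBk (C : set U) (F : set U -> nat -> R) :
    \prod_(k <= i < n) F (Bk C i) i = F C k * \prod_(k.+1 <= i < n) F (B i) i.
  rewrite big_ltn// {1}/Bk eqxx; congr (_ * _); apply: eq_big_nat => i /andP[ki _].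
  by rewrite /Bk gtn_eqF.
(* The case k of the induction, with the mark V k tested against C. *)
have IHW (Y' : Omega -> R) C : measurable_fun (setT : set mG) Y' -> (forall w, 0 <= Y' w <= 1) ->
    measurable C ->
    (\int[P]_w (W w * (Y' w * \1_C (V k w)))%:E =
     \int[P]_w (Y w * Y' w * \prod_(0 <= i < k) mark_mean i (X i w))%:E *
     (fine (mu C) * \prod_(k.+1 <= i < n) fine (mu (B i)))%:E)%E.
  move=> mY' Y'01 mC; rewrite -(prodBk C (fun D i => fine (mu D))) -IH//.
  - apply: eq_integral => w _; congr EFin.
    by rewrite (prodBk C (fun D i => \1_D (V i w))) /W; ring.
  - exact: measurable_funM.
  - by move=> w; exact: mul01.
  - by move=> i; exact: mBk.
have W1 w : W w = W w * (1 * \1_setT (V k w)) by rewrite indicT !mulr1.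
pose mid := (@measurable_id _ (Omega * U)%type setT).
have mWf : measurable_fun setT (fun z : Omega * U => W z.1) by exact: measurableT_comp.
have mXf : measurable_fun setT (fun z : Omega * U => (X k z.1, z.2)).
  by apply: measurable_fun_pair => //; exact: (measurableT_comp (mXO k)).
have rect (C : set (R * U)) : measurable C ->
    wlaw_measure P mW W0 (mXV k) C =
    wlaw_measure (P \x mu)%E mWf (fun z => W0 z.1) mXf C.
  apply: measure_rectangles_unique; last first.
    rewrite /= /wlaw_measure /wlaw preimage_setT.
    exact: le_lt_trans (integral01_le1 P mW W01) (ltry 1).
  move=> A C' mA mC'; rewrite /= /wlaw_measure !wlawE.
  have mAX : measurable_fun (setT : set mG) (fun w => \1_A (X k w) : R).
    by apply: measurableT_comp => //; exact: measurable_indic.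
  have mAXO := measurable_fun_g_sigma_algebra Gm mAX.
  have WA : (\int[P]_w (W w * \1_A (X k w))%:E =
      \int[P]_w (Y w * \1_A (X k w) * \prod_(0 <= i < k) mark_mean i (X i w))%:E *
      (\prod_(k.+1 <= i < n) fine (mu (B i)))%:E)%E.
    have := IHW _ setT mAX (fun w => ind01 A (X k w)) measurableT.
    rewrite probability_setT mul1r => <-.
    by apply: eq_integral => w _; rewrite indicT mulr1.
  under eq_integral do rewrite indic_setX.
  rewrite IHW// mulrC EFinM muleA -WA.
  rewrite fubini_tonelli1/=; last 2 first.
  - apply/measurable_EFinP; apply: measurable_funM => //.
    by apply: measurableT_comp => //; apply: measurable_indic; exact: measurableX.
  - move=> z; rewrite lee_fin mulr_ge0//.
  rewrite /fubini_F -ge0_integralZr//; last 3 first.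
  - by apply/measurable_EFinP; exact: measurable_funM.
  - by move=> w _; rewrite lee_fin mulr_ge0.
  - by rewrite lee_fin fine_ge0.
  apply: eq_integral => w _.
  under [RHS]eq_integral do rewrite indic_setX mulrA EFinM/=.
  rewrite ge0_integralZl//.
  - by rewrite integral_indic// setIT fineK// fin_num_measure.
  - by apply/measurable_EFinP; exact: measurable_indic.
  - by rewrite lee_fin mulr_ge0.
have gE (w : Omega) v : (0 <= (g k (X k w, v))%:E)%E by rewrite lee_fin; have /andP[] := g01 k (X k w, v).
transitivity (\int[P]_w ((g k (X k w, V k w))%:E * (W w)%:E))%E.
  by apply: eq_integral => w _; rewrite -EFinM big_nat_recr//= /W; congr EFin; ring.
have mgk : measurable_fun setT (fun z => (g k z)%:E) by exact/measurable_EFinP.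
have gk0 z : (0 <= (g k z)%:E)%E by rewrite lee_fin; have /andP[] := g01 k z.
rewrite -(integral_wlaw P mW W0 (mXV k) mgk gk0).
rewrite (eq_measure_integral (wlaw_measure (P \x mu)%E mWf (fun z => W0 z.1) mXf)); last first.
  by move=> C mC _; exact: rect.
rewrite (integral_wlaw (P \x mu)%E mWf (fun z => W0 z.1) mXf mgk gk0).
rewrite fubini_tonelli1/=; last 2 first.
- by apply: emeasurable_funM; apply/measurable_EFinP => //; exact: measurableT_comp.
- by move=> z; rewrite mule_ge0// lee_fin.
(* The induction hypothesis serves a second time, with weight [mark_mean k (X k)] and the sure event
   for [V k], to integrate out the earlier marks. *)
have := IHW _ setT (mmeanX k) (fun w => mark_mean01 k (X k w)) measurableT.
rewrite probability_setT mul1r => H.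
transitivity (\int[P]_w (W w * (mark_mean k (X k w) * \1_setT (V k w)))%:E)%E.
  apply: eq_integral => w _; rewrite /fubini_F/= ge0_integralZr ?lee_fin//.
    by rewrite mark_meanE -EFinM indicT mulr1 mulrC.
  exact/measurable_EFinP.
rewrite H; congr (_ * _)%E; apply: eq_integral => w _.
by rewrite big_nat_recr//=; congr EFin; ring.
Qed.

Lemma integral_marks n :
  (\int[P]_w (\prod_(0 <= i < n) g i (X i w, V i w))%:E =
   \int[P]_w (\prod_(0 <= i < n) mark_mean i (X i w))%:E)%E.
Proof.
have := @integral_marks_indic n n (cst 1) (fun=> setT) (leqnn n).
rewrite (big_geq (leqnn n)) mule1 /cst => H.
under [RHS]eq_integral do rewrite -[X in X%:E]mul1r.
rewrite -H//; last by move=> w; rewrite ler01 lexx.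
by apply: eq_integral => w _; rewrite (big_geq (leqnn n)) mul1r mulr1.
Qed.

End marks.

(** * Lebesgue measure and product laws *)

Section translation.
Context {R : realType}.
Local Notation mR := (measurableTypeR R).

Lemma lebesgue_measure_shift (x : R) (A : set mR) : measurable A ->
  pushforward (@lebesgue_measure R) (fun y : mR => y - x : mR) A = lebesgue_measure A.
Proof.
move=> mA; apply/esym/lebesgue_measure_unique => //=; first exact: measurable_funB.
move=> _ _ [[a b]] _ <-.
rewrite /pushforward.
have -> : (fun y : mR => y - x) @^-1` `]a, b] = `]a + x, b + x]%classic.
  by apply/seteqP; split => y /=; rewrite !in_itv/= ltrBrDr lerBlDr.
by rewrite !lebesgue_measure_itv/= !lte_fin ltrD2r; case: ifP => // _;
  rewrite -!EFinB; congr EFin; ring.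
Qed.

Lemma laplace_shift (f : R -> R) (s x : R) : measurable_fun setT f ->
  (forall y, 0 <= f y) -> (forall y, y < 0 -> f y = 0) -> 0 <= x ->
  laplace (fun L => f (L - x)) s = ((expR (- (s * x)))%:E * laplace f s)%E.
Proof.
move=> mf f0 fN x0.
have mE (h : R -> R) : measurable_fun (setT : set mR) h ->
    measurable_fun (setT : set mR) (fun y => (expR (- (s * y)) * h y)%:E).
  move=> mh; apply/measurable_EFinP; apply: measurable_funM => //.
  by apply: measurableT_comp => //; apply: measurableT_comp => //; exact: measurable_funM.
(* [f] and its translate by [x >= 0] both vanish on the negative reals, so both integrals extend to
   the whole line, where translation preserves Lebesgue measure. *)
have toT (h : R -> R) : (forall y, y < 0 -> h y = 0) ->
    laplace h s = (\int[lebesgue_measure]_(y in (setT : set mR)) (expR (- (s * y)) * h y)%:E)%E.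
  move=> hN; rewrite /laplace integral_mkcond; apply: eq_integral => y _.
  rewrite patchE; case: ifPn => //; rewrite notin_setE/= in_itv/= andbT => /negP.
  by rewrite -ltNge => y0; rewrite hN ?mulr0.
rewrite !toT//; last by move=> y y0; rewrite fN//; lra.
rewrite -ge0_integralZl//; last 2 first.
- exact: mE.
- by move=> y _; rewrite lee_fin mulr_ge0// expR_ge0.
have msh : measurable_fun (setT : set mR) (fun y : mR => y - x : mR) by exact: measurable_funB.
rewrite [RHS](eq_measure_integral (pushforward (@lebesgue_measure R) (fun y : mR => y - x : mR))); last first.
  by move=> A mA _; exact/esym/lebesgue_measure_shift.
rewrite ge0_integral_pushforward//; last 2 first.
- by apply: emeasurable_funM => //; exact: mE.
- by move=> y _; rewrite mule_ge0// lee_fin ?mulr_ge0// expR_ge0.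
apply: eq_integral => y _ /=; rewrite -EFinM mulrA -expRD; congr (expR _ * _)%:E; ring.
Qed.

End translation.

(** The passage from products of fixed length [n] to products of random length: pointwise they agree
    from some [n] on, with no uniform bound on this [n]. *)
Lemma integral_eventually d (T : measurableType d) (R : realType)
    (P : probability T R) (f_ : nat -> T -> R) (f : T -> R) :
  (forall n, measurable_fun setT (f_ n)) -> (forall n w, 0 <= f_ n w <= 1) ->
  (forall w, exists m, forall n, (m <= n)%N -> f_ n w = f w) ->
  (\int[P]_w (f_ n w)%:E)%E @[n --> \oo] --> (\int[P]_w (f w)%:E)%E.
Proof.
move=> mf_ f01 ev.
have cvgf w : (f_ n w)%:E @[n --> \oo] --> (f w)%:E.
  have [m mE] := ev w; apply: cvg_near_cst; exists m => // n /= mn.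
  by rewrite mE.
have mf : measurable_fun setT (EFin \o f).
  apply: (emeasurable_fun_cvg (fun n w => (f_ n w)%:E)) => //.
  by move=> n; exact/measurable_EFinP.
have [] // := @dominated_convergence _ T R P setT measurableT
  (fun n w => (f_ n w)%:E) (EFin \o f) (cst 1%E).
- by move=> n; exact/measurable_EFinP.
- by apply: aeW => w _.
- exact: finite_measure_integrable_cst.
- by apply: aeW => w n _; rewrite lee_fin; have /andP[? ?] := f01 n w; rewrite ger0_norm.
Qed.

Lemma integral_indep_prod (R : realType) (mu : probability (R * R)%type R)
    (f g : R -> R) :
  (forall A B : set R, measurable A -> measurable B ->
      mu (A `*` B) = (mu (A `*` setT) * mu (setT `*` B))%E) ->
  measurable_fun setT f -> measurable_fun setT g ->
  (forall x, 0 <= f x) -> (forall x, 0 <= g x) ->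
  (\int[mu]_v (f v.1 * g v.2)%:E =
   \int[mu]_v (f v.1)%:E * \int[mu]_v (g v.2)%:E)%E.
Proof.
move=> indep_mu mf mg f0 g0.
(* Independence of the coordinates means that [mu] is the image of [mu \x mu] under [Z]; Tonelli's
   theorem then separates the factors. *)
pose Z (z : (R * R) * (R * R)) := (z.1.1, z.2.2).
have mZ : measurable_fun setT Z.
  by apply: measurable_fun_pair; apply: measurableT_comp.
have m1 : measurable_fun [set: (R * R) * (R * R)] (cst (1 : R)) by [].
have p0 : forall z : (R * R) * (R * R), 0 <= cst (1 : R) z by [].
have muE C : measurable C -> mu C = wlaw_measure (mu \x mu)%E m1 p0 mZ C.
  apply: measure_rectangles_unique; last first.
    by apply: le_lt_trans (probability_le1 mu measurableT) _; rewrite ltry.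
  move=> A B mA mB; rewrite [LHS]indep_mu//= /wlaw_measure /wlaw.
  rewrite [X in integral _ X _](_ : _ = (A `*` setT) `*` (setT `*` B)); last first.
    by apply/seteqP; split => -[[a b] [c e]] /= [] //= [? _] [].
  rewrite (eq_integral (cst 1%E))// integral_cst; last by apply: measurableX; exact: measurableX.
  by rewrite mul1e; apply/esym; apply: product_measure1E; exact: measurableX.
have mf1 : measurable_fun setT (fun v : R * R => (f v.1)%:E).
  by apply/measurable_EFinP; exact: measurableT_comp.
have mg2 : measurable_fun setT (fun v : R * R => (g v.2)%:E).
  by apply/measurable_EFinP; exact: measurableT_comp.
rewrite (eq_measure_integral (wlaw_measure (mu \x mu)%E m1 p0 mZ)); last first.
  by move=> A mA _; exact: muE.
rewrite integral_wlaw; last 2 first.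
- by apply/measurable_EFinP; apply: measurable_funM; exact: measurableT_comp.
- by move=> v; rewrite lee_fin mulr_ge0.
rewrite fubini_tonelli1/=; last 2 first.
- apply: emeasurable_funM => //; apply/measurable_EFinP.
  by apply: measurable_funM; apply: measurableT_comp => //; exact: measurableT_comp.
- by move=> z; rewrite mule_ge0// lee_fin// mulr_ge0.
rewrite -ge0_integralZr//; last 2 first.
- by move=> v _; rewrite lee_fin.
- by apply: integral_ge0 => v _; rewrite lee_fin.
apply: eq_integral => v _; rewrite /fubini_F/=.
under eq_integral do rewrite mule1 EFinM.
by rewrite ge0_integralZl// ?lee_fin// => u _; rewrite lee_fin.
Qed.

(** * The shock model *)

Section shock_model.
Context {R : realType} d (Omega : measurableType d) (P : probability Omega R).
Variables (lam : R -> R) (N : R -> Omega -> nat) (T : nat -> Omega -> R).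
Variables (V1 V2 : nat -> Omega -> R) (mu : probability (R * R)%type R).
Variables (G : R -> Omega -> R) (q : R -> R) (t : R).
Local Notation mR := (measurableTypeR R).
Hypothesis mlam : measurable_fun setT lam.
Hypothesis lam0 : forall x, 0 <= lam x.
Hypothesis ilam : forall x, 0 <= x ->
  lebesgue_measure.-integrable `[0%R, x]%classic (fun y => (lam y)%:E).
Hypothesis HN : nhpp P lam N T.
Hypothesis mV : forall i, (0 < i)%N -> measurable_fun setT (fun w => (V1 i w, V2 i w)).
Hypothesis V0 : forall i w, (0 < i)%N -> 0 <= V1 i w /\ 0 <= V2 i w.
Hypothesis lawV : forall i (B : set (R * R)%type), (0 < i)%N -> measurable B ->
  P ((fun w => (V1 i w, V2 i w)) @^-1` B) = mu B.
Hypothesis mG : forall s, 0 <= s -> measurable_fun setT (G s).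
Hypothesis G0 : forall s u w, 0 <= s <= u -> 0 <= G s w <= G u w.
Hypothesis mq : measurable_fun setT q.
Hypothesis q01 : forall x, 0 <= q x <= 1.
Hypothesis indepF : indep P (shock_family N V1 V2 G).
Hypothesis t0 : 0 <= t.

Let mT i : measurable_fun setT (T i).
Proof. by move: HN => [_ [_ [_ [_ [_ [+ _]]]]]]; apply. Qed.

Let mNt := measurable_count HN t0.

Let T_le w i : (0 < i <= N t w)%N -> T i w <= t.
Proof. by move=> /andP[i0 it]; rewrite (point_le HN i0 t0 it). Qed.

Let mVi i : measurable_fun setT (fun w => (V1 i.+1 w, V2 i.+1 w)).
Proof. exact: mV. Qed.

Let mV1 i : measurable_fun setT (V1 i.+1).
Proof. by have /measurable_fun_pairP[] := mVi i. Qed.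

Let mV2 i : measurable_fun setT (V2 i.+1).
Proof. by have /measurable_fun_pairP[] := mVi i. Qed.

Let measF k : shock_family N V1 V2 G k `<=` measurable.
Proof.
case: k => [|[|k]] A.
- apply: smallest_sub; first exact: sigma_algebra_measurable.
  move=> _ [s [k [s0 ->]]].
  exact: (measurable_preimage (A := [set k]) (measurable_count HN s0)).
- apply: smallest_sub; first exact: sigma_algebra_measurable.
  by move=> _ [s [B [s0 [mB ->]]]]; apply: measurable_preimage => //; exact: mG.
- by move=> [B [mB ->]]; exact: measurable_preimage.
Qed.

Let GN := [set A : set Omega | exists s k, 0 <= s /\ A = [set w | N s w = k]].

Let GNm : GN `<=` measurable.
Proof.
move=> _ [s [k [s0 ->]]].
exact: (measurable_preimage (A := [set k]) (measurable_count HN s0)).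
Qed.

Let mN_GN s : 0 <= s -> measurable_fun (setT : set (g_sigma_algebraType GN)) (N s).
Proof.
by move=> s0; apply: measurable_fun_nat => k; apply: sub_sigma_algebra; exists s, k.
Qed.

Let indepV (Y : Omega -> R) (B : nat -> set (R * R)) n :
  measurable_fun (setT : set (g_sigma_algebraType GN)) Y -> (forall w, 0 <= Y w <= 1) ->
  (forall i, measurable (B i)) ->
  (\int[P]_w (Y w * \prod_(0 <= i < n) \1_(B i) (V1 i.+1 w, V2 i.+1 w))%:E =
   \int[P]_w (Y w)%:E * (\prod_(0 <= i < n) fine (mu (B i)))%:E)%E.
Proof.
move=> mY Y01 mB.
have mYO := measurable_fun_g_sigma_algebra GNm mY.
(* In [shock_family] the mark of index [i.+1] sits at position [i.+2], and it is tested against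
   [B i]. *)
pose A j := (fun w => (V1 j.-1 w, V2 j.-1 w)) @^-1` B j.-2.
have := @integral_prod_indep_indic _ _ _ P _ _ indepF measF (fun=> Y) A
  [:: 0%N] [seq i.+2 | i <- index_iota 0 n].
rewrite !big_seq1 !big_map => H.
rewrite -[X in (X * _)%E]fineK ?integral01_fin_num// -EFinM.
rewrite (eq_bigr (fun i => fine (P (A i.+2)))); last first.
  by move=> i _; congr fine; rewrite -(lawV (i := i.+1)).
rewrite -H//.
- by apply: eq_integral => w _; rewrite big_seq1 big_map.
- rewrite cons_uniq map_inj_uniq ?iota_uniq ?andbT; last by move=> i j [].
  by apply/mapP => -[].
- move=> i C; rewrite inE => /eqP -> mC; exact: (measurable_preimage mY mC).
- by move=> _ /mapP[i _ ->]; exists (B i).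
Qed.

(** Any value above [t] would do for the missing points. Being a constant it keeps [X i] measurable
    for the sigma-algebra of the counts, and [mark] equals 1 there. *)
Let X i w := if (i < N t w)%N then T i.+1 w else t + 1.

Let mX i : measurable_fun (setT : set (g_sigma_algebraType GN)) (X i).
Proof.
apply: (measurability (@RGenOInfty.G R)); first exact: RGenOInfty.measurableE.
move=> _ [_ [b ->] <-]; rewrite setTI.
have [tb|bt] := leP (t + 1) b.
  rewrite (_ : _ @^-1` _ = set0)//; apply/seteqP; split => // w /=.
  rewrite in_itv/= andbT /X; case: ifPn => [it|_]; last by rewrite ltNge tb.
  have := @T_le w i.+1 it; move=> Tt bT; suff : b < b by rewrite ltxx.
  by apply: lt_le_trans bT _; apply: le_trans Tt _; apply: le_trans tb; rewrite lerDl.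
pose c := Num.min t (Num.max 0 b).
have c0 : 0 <= c by rewrite /c le_min t0 le_max lexx.
have ct : c <= t by rewrite /c ge_min lexx.
(* [X i] exceeds [b < t + 1] exactly when at most [i] points have occurred by time [c], the clamped
   [b]; this event depends on the counts alone. *)
have E w : (b < X i w) = (N c w <= i)%N.
  rewrite /X; case: ifPn => [it|]; last first.
    rewrite -leqNgt => it; rewrite bt; apply/esym; apply: leq_trans it.
    by move: HN => [_ [_ [+ _]]]; apply; rewrite c0.
  rewrite leqNgt -(point_le HN (ltn0Sn i) t0 it)// -ltNge.
  have Tt : T i.+1 w <= t by exact: T_le.
  have T0 := point_gt0 HN (ltn0Sn i) t0 it.
  by rewrite /c gt_min gt_max T0/= ltNge Tt.
rewrite (_ : _ @^-1` _ = N c @^-1` [set k | (k <= i)%N]); last first.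
  by apply/seteqP; split => w /=; rewrite in_itv/= andbT E.
exact: (measurable_preimage (mN_GN c0)).
Qed.

(** * The expectation of the product over points and marks *)

Section laplace_exponent.
Variable s : R.
Hypothesis s0 : 0 <= s.

(* Truncating the exponential at 1 changes nothing on the support of mu. *)
Let mark (z : R * (R * R)) : R := if z.1 <= t then
  q z.1 * Num.min 1 (expR (- ((t - z.1) * z.2.1) - s * z.2.2)) else 1.

Let mark01 z : 0 <= mark z <= 1.
Proof.
rewrite /mark; case: ifP => _; last by rewrite ler01 lexx.
have /andP[q0 q1] := q01 z.1.
have m0 : 0 <= Num.min 1 (expR (- ((t - z.1) * z.2.1) - s * z.2.2)).
  by rewrite le_min ler01 expR_ge0.
by rewrite mulr_ge0//= mulr_ile1// ge_min lexx.
Qed.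

Let mexponent : measurable_fun setT
  (fun z : R * (R * R) => expR (- ((t - z.1) * z.2.1) - s * z.2.2)).
Proof.
apply: measurableT_comp => //; apply: measurable_funB; last first.
  by apply: measurable_funM => //; exact: measurableT_comp.
apply: measurableT_comp => //; apply: measurable_funM; last exact: measurableT_comp.
exact: measurable_funB.
Qed.

Let mmark : measurable_fun setT mark.
Proof.
apply: measurable_fun_ifT => //; first exact: measurable_fun_ler.
apply: measurable_funM; first exact: measurableT_comp.
exact: measurable_minr.
Qed.

(** [mu] is known only as the law of the marks; its concentration on the non-negative quadrant is
    read off from [V_1]. *)
Lemma integral_mark_law (f : R * R -> R) : measurable_fun setT f -> (forall v, 0 <= f v) ->
  (\int[mu]_v (f v)%:E = \int[P]_w (f (V1 1 w, V2 1 w))%:E)%E.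
Proof.
move=> mf f0.
have mE : measurable_fun setT (fun v => (f v)%:E) by exact/measurable_EFinP.
have m1 : measurable_fun [set: Omega] (cst (1 : R)) by [].
have p0 : forall w : Omega, 0 <= cst (1 : R) w by [].
rewrite (eq_measure_integral (wlaw_measure P m1 p0 (mVi 0))); last first.
  move=> A mA _; rewrite /= /wlaw_measure /wlaw (eq_integral (cst 1%E))// integral_cst.
    by rewrite mul1e; exact/esym/lawV.
  exact: measurable_preimage.
rewrite integral_wlaw//.
by apply: eq_integral => w _; rewrite /= mule1.
Qed.

Lemma mu_ltE u : 0 <= u ->
  (\int[mu]_v (Num.min 1 (expR (- (u * v.1) - s * v.2)))%:E = (mu_lt mu u s)%:E)%E.
Proof.
move=> u0.
have mE : measurable_fun setT (fun v : R * R => expR (- (u * v.1) - s * v.2)).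
  apply: measurableT_comp => //; apply: measurable_funB; last exact: measurable_funM.
  by apply: measurableT_comp => //; exact: measurable_funM.
have mM : measurable_fun setT (fun v : R * R => Num.min 1 (expR (- (u * v.1) - s * v.2))).
  exact: measurable_minr.
have minE : (\int[mu]_v (expR (- (u * v.1) - s * v.2))%:E =
             \int[mu]_v (Num.min 1 (expR (- (u * v.1) - s * v.2)))%:E)%E.
  rewrite integral_mark_law//.
  rewrite integral_mark_law//.
  apply: eq_integral => w _ /=; rewrite (min_idPr _)// expR_le1.
  by have [v1 v2] := V0 w (ltn0Sn 0); rewrite subr_le0 (@le_trans _ _ 0)// ?oppr_le0 mulr_ge0.
rewrite /mu_lt minE fineK//; apply: integral01_fin_num => // v.
by rewrite le_min ler01 expR_ge0 ge_min lexx.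
Qed.

Let mark_meanE x : x <= t -> mark_mean mu (fun=> mark) 0 x = q x * mu_lt mu (t - x) s.
Proof.
move=> xt; rewrite /mark_mean /mark /= xt.
under eq_integral do rewrite EFinM.
have /andP[q0 _] := q01 x.
rewrite ge0_integralZl//.
- by rewrite mu_ltE ?subr_ge0.
- apply/measurable_EFinP; apply: measurable_minr => //.
  exact: (measurableT_comp mexponent (pair1_measurable x)).
Qed.

Lemma integral_prod_marks :
  (\int[P]_w (\prod_(1 <= i < (N t w).+1)
      (q (T i w) * expR (- ((t - T i w) * V1 i w) - s * V2 i w)))%:E =
   (expR (nu_exponent lam q mu t s))%:E)%E.
Proof.
pose h := mark_mean mu (fun=> mark) 0.
have mh : measurable_fun setT h.
  exact: (measurable_mark_mean mu (fun=> mmark) (fun=> mark01)).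
have h01 : forall x, 0 <= h x <= 1 by move=> x; exact: (mark_mean01 mu (fun=> mmark) (fun=> mark01)).
have Xge w i : (N t w <= i)%N -> X i w = t + 1 by move=> Ni; rewrite /X ltnNge Ni.
have Xlt w i : (i < N t w)%N -> X i w = T i.+1 w by rewrite /X => ->.
have ht1 : h (t + 1) = 1.
  rewrite /h /mark_mean /mark /= gerDl ler10 integral_cst// mul1e.
  by rewrite [X in fine X](_ : _ = 1%E)//; exact: (probability_setT mu).
(* Beyond [N t w] all factors are taken at [t + 1] and equal 1, so the products are constant from
   there on. This applies to the marks and to their means alike. *)
have cut (F : R -> nat -> R) w : (forall i, F (t + 1) i = 1) -> exists m, forall n, (m <= n)%N ->
    \prod_(0 <= i < n) F (X i w) i = \prod_(0 <= i < N t w) F (T i.+1 w) i.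
  move=> F1; exists (N t w) => n mn; rewrite (@big_cat_nat _ _ _ (N t w))//=.
  rewrite [X in _ * X]big1_seq ?mulr1; last first.
    by move=> i; rewrite mem_index_iota => /andP[_ /andP[Ni _]]; rewrite Xge.
  by apply: eq_big_nat => i /andP[_ iN]; rewrite Xlt.
have pr01 (I : Type) (r : seq I) (F : I -> R) : (forall i, 0 <= F i <= 1) ->
    0 <= \prod_(i <- r) F i <= 1.
  move=> F01; rewrite prodr_ile1 ?andbT => [|i _]; last exact: F01.
  by apply: prodr_ge0 => i _; have /andP[] := F01 i.
have mXO i : measurable_fun setT (X i) by exact: measurable_fun_g_sigma_algebra (mX i).
have cvg1 : (\int[P]_w (\prod_(0 <= i < n) mark (X i w, (V1 i.+1 w, V2 i.+1 w)))%:E)%E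
    @[n --> \oo] -->
    (\int[P]_w (\prod_(0 <= i < N t w) mark (T i.+1 w, (V1 i.+1 w, V2 i.+1 w)))%:E)%E.
  apply: integral_eventually.
  - move=> n; apply: measurable_prod => i _; apply: (measurableT_comp mmark).
    exact: measurable_fun_pair.
  - by move=> n w; exact: pr01.
  - move=> w; apply: (cut (fun x i => mark (x, (V1 i.+1 w, V2 i.+1 w)))) => i.
    by rewrite /mark /= gerDl ler10.
have cvg2 : (\int[P]_w (\prod_(0 <= i < n) h (X i w))%:E)%E @[n --> \oo] -->
    (\int[P]_w (\prod_(0 <= i < N t w) h (T i.+1 w))%:E)%E.
  apply: integral_eventually.
  - by move=> n; apply: measurable_prod => i _; exact: measurableT_comp.
  - by move=> n w; exact: pr01.
  - by move=> w; apply: (cut (fun x i => h x)).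
transitivity (\int[P]_w (\prod_(0 <= i < N t w) mark (T i.+1 w, (V1 i.+1 w, V2 i.+1 w)))%:E)%E.
  apply: eq_integral => w _; rewrite big_add1/=; congr EFin.
  apply: eq_big_nat => i /andP[_ iN]; rewrite /mark /= T_le// (min_idPr _)// expR_le1.
  have [v1 v2] := V0 w (ltn0Sn i).
  by rewrite subr_le0 (@le_trans _ _ 0)// ?oppr_le0 mulr_ge0// subr_ge0 T_le.
transitivity (\int[P]_w (\prod_(0 <= i < N t w) h (T i.+1 w))%:E)%E.
  rewrite -(cvg_lim _ cvg1)// -(cvg_lim _ cvg2)//.
  apply: congr_lim; apply/funext => n.
  exact: (integral_marks (mu := mu) GNm mVi mX (fun=> mmark) (fun=> mark01) indepV).
transitivity (\int[P]_w (\prod_(1 <= i < (N t w).+1) h (T i w))%:E)%E.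
  by apply: eq_integral => w _; rewrite big_add1.
rewrite (pgfl mlam lam0 ilam HN t0 mh h01); congr (expR _)%:E.
rewrite integral_intensity; last 2 first.
- by apply/measurable_EFinP; exact: measurable_funB.
- by move=> x; rewrite lee_fin subr_ge0; have /andP[] := h01 x.
have hE x : x \in `[0, t]%classic -> h x = q x * mu_lt mu (t - x) s.
  by rewrite inE/= in_itv/= => /andP[_ xt]; exact: mark_meanE.
have iqh : lebesgue_measure.-integrable `[0, t]%classic (EFin \o (fun x => h x * lam x)).
  apply: (le_integrable _ _ _ (ilam t0)) => //.
  - apply/measurable_funTS/measurable_EFinP; exact: measurable_funM.
  - move=> x _; rewrite lee_fin ger0_norm ?mulr_ge0//; last by have /andP[] := h01 x.
    by rewrite ger0_norm// ler_piMl//; have /andP[] := h01 x.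
rewrite /nu_exponent; transitivity (- (Lambda lam t - Rintegral lebesgue_measure `[0, t]%classic (fun x => h x * lam x))).
  congr (- _); rewrite -[X in X - _]/(Rintegral lebesgue_measure `[0, t]%classic lam).
  rewrite -RintegralB//; last exact: ilam.
  by congr fine; apply: eq_integral => x _; rewrite -EFinM; congr EFin; ring.
rewrite opprB addrC; congr (_ + _); congr fine; apply: eq_integral => x xt.
by rewrite hE//; congr EFin; ring.
Qed.

End laplace_exponent.

(** * The measure [nu_t], the convolution formula and the Laplace transform of [phi_t] *)

Let W w := expR (- \sum_(1 <= i < (N t w).+1) (V1 i w * (t - T i w))) *
  \prod_(1 <= i < (N t w).+1) q (T i w).
Let S w := \sum_(1 <= i < (N t w).+1) V2 i w.
Let F := cdfG P (G t).

Let mW : measurable_fun setT W.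
Proof.
apply: measurable_funM.
  apply: measurableT_comp => //; apply: measurableT_comp => //.
  apply: (@measurable_fun_nat_index _ _ _ _
    (fun n w => \sum_(1 <= i < n.+1) (V1 i w * (t - T i w))) (N t)) => // n.
  under eq_fun do rewrite big_add1/=.
  by apply: measurable_sum => i; apply: measurable_funM => //; exact: measurable_funB.
apply: (@measurable_fun_nat_index _ _ _ _
  (fun n w => \prod_(1 <= i < n.+1) q (T i w)) (N t)) => // n.
by apply: measurable_prod => i _; exact: (measurableT_comp mq (mT i)).
Qed.

Let mS : measurable_fun setT S.
Proof.
apply: (@measurable_fun_nat_index _ _ _ _
  (fun n w => \sum_(1 <= i < n.+1) V2 i w) (N t)) => // n.
by under eq_fun do rewrite big_add1/=; exact: measurable_sum.
Qed.

Let W01 w : 0 <= W w <= 1.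
Proof.
have pq : 0 <= \prod_(1 <= i < (N t w).+1) q (T i w) <= 1.
  rewrite prodr_ile1 ?andbT => [|i _]; last exact: q01.
  by apply: prodr_ge0 => i _; have /andP[] := q01 (T i w).
rewrite /W mulr_ge0 ?expR_ge0//=; last by have /andP[] := pq.
rewrite mulr_ile1// ?expR_ge0//; [by have /andP[] := pq| |by have /andP[] := pq].
rewrite expR_le1 oppr_le0 big_nat sumr_ge0// => i /andP[i0 iN].
have [v1 _] := V0 w i0; rewrite mulr_ge0// subr_ge0 T_le//.
by rewrite i0.
Qed.

Let W0 w : 0 <= W w. Proof. by have /andP[] := W01 w. Qed.

Let S0 w : 0 <= S w.
Proof. by rewrite /S big_nat sumr_ge0// => i /andP[i0 _]; have [] := V0 w i0. Qed.

Let F01 x : 0 <= F x <= 1.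
Proof.
by rewrite /F /cdfG fine_ge0//= -lee_fin fineK ?fin_num_measure ?probability_le1//;
  exact: (measurable_preimage (A := `]-oo, x]%classic) (mG t0)).
Qed.

Let mleG x : measurable [set w | G t w <= x].
Proof.
rewrite (_ : [set w | _] = G t @^-1` `]-oo, x]%classic).
  exact: measurable_preimage (mG t0) _.
by apply/seteqP; split => w /=; rewrite in_itv.
Qed.

Let mF : measurable_fun setT F.
Proof.
apply: nondecreasing_measurable => // x y xy.
rewrite fine_le ?fin_num_measure//; apply: le_measure; rewrite ?inE//.
by move=> w /= Gx; exact: le_trans xy.
Qed.

Let FN x : x < 0 -> F x = 0.
Proof.
move=> x0; rewrite /F /cdfG (_ : [set w | _] = set0) ?measure0//.
apply/seteqP; split => // w /= Gx.
have /andP[Gt _] := G0 w (s := t) (u := t) (introT andP (conj t0 (lexx t))).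
by have := le_lt_trans (le_trans Gt Gx) x0; rewrite ltxx.
Qed.

Let integral_weight s : 0 <= s ->
  (\int[P]_w (expR (- (s * S w)) * W w)%:E = (expR (nu_exponent lam q mu t s))%:E)%E.
Proof.
move=> s0; rewrite -integral_prod_marks//; apply: eq_integral => w _; congr EFin.
rewrite big_split/= -expR_sum /W mulrA -expRD mulrC; congr (_ * expR _).
rewrite /S mulr_sumr -opprD -big_split/= -sumrN.
by apply: eq_bigr => i _; ring.
Qed.

Let nu0 : {measure set R -> \bar R} := wlaw_measure P mW W0 mS.

Let integral_nu0 (f : R -> R) : measurable_fun setT f -> (forall x, 0 <= f x) ->
  (\int[nu0]_(x in `[0%R, +oo[%classic) (f x)%:E = \int[P]_w (f (S w) * W w)%:E)%E.
Proof.
move=> mf f0; rewrite integral_mkcond integral_wlaw.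
- apply: eq_integral => w _; rewrite patchE mem_set//= in_itv/= S0//.
- apply/(measurable_restrictT _ _).1 => //.
  by apply/measurable_EFinP; exact: measurable_funTS.
- by apply: erestrict_ge0 => x _; rewrite lee_fin.
Qed.

Let is_nu_nu0 : is_nu lam q mu t nu0.
Proof.
split.
  rewrite /nu0 /= /wlaw_measure /wlaw (_ : S @^-1` _ = set0) ?integral_set0//.
  by apply/seteqP; split => // w /=; rewrite in_itv/= ltNge S0.
move=> s s0; rewrite (integral_nu0 (f := fun x => expR (- (s * x)))).
- exact: integral_weight.
- by apply: measurableT_comp => //; apply: measurableT_comp => //; exact: measurable_funM.
- by move=> x; exact: expR_ge0.
Qed.

Lemma exists_nu : exists nu : {measure set R -> \bar R}, is_nu lam q mu t nu.
Proof. by exists nu0; exact: is_nu_nu0. Qed.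

Let mFS L : measurable_fun setT (fun w => F (L - S w)).
Proof. by apply: measurableT_comp => //; exact: measurable_funB. Qed.

Let phiE L : (shock_phi P N T V1 V2 G q t L)%:E = (\int[P]_w (F (L - S w) * W w)%:E)%E.
Proof.
rewrite /shock_phi -[RHS]fineK.
  by congr (fine _)%:E; apply: eq_integral => w _; rewrite mulrA.
apply: integral01_fin_num; first exact: measurable_funM.
move=> w; have /andP[a0 a1] := F01 (L - S w); have /andP[b0 b1] := W01 w.
by rewrite mulr_ge0//= mulr_ile1.
Qed.

Lemma shock_phi_conv nu L : is_nu lam q mu t nu ->
  ((shock_phi P N T V1 V2 G q t L)%:E =
   \int[nu]_(x in `[0%R, +oo[%classic) (cdfG P (G t) (L - x))%:E)%E.
Proof.
move=> [nuN nuE]; have [nu0N nu0E] := is_nu_nu0.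
rewrite phiE -(integral_nu0 (f := fun x => F (L - x))); last 2 first.
- by apply: measurableT_comp => //; exact: measurable_funB.
- by move=> x; have /andP[] := F01 (L - x).
apply: eq_measure_integral => A mA _.
exact: (laplace_transform_unique nu0N nuN nu0E nuE).
Qed.

Lemma laplace_shock_phi s : 0 <= s ->
  laplace (shock_phi P N T V1 V2 G q t) s =
  (laplace (cdfG P (G t)) s * (expR (nu_exponent lam q mu t s))%:E)%E.
Proof.
move=> s0.
(* The indicator restricts [L] to the half-line, so that Tonelli's theorem applies on the full
   product space. *)
pose f (z : mR * Omega) : \bar R :=
  (\1_`[0%R, +oo[%classic z.1 * (expR (- (s * z.1)) * (F (z.1 - S z.2) * W z.2)))%:E.
have mf : measurable_fun setT f.
  apply/measurable_EFinP; apply: measurable_funM.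
    by apply: measurableT_comp => //; apply: measurable_indic; exact: measurable_itv.
  apply: measurable_funM.
    do 2 apply: measurableT_comp => //; apply: measurable_funM => //.
  apply: measurable_funM; last exact: measurableT_comp.
  apply: measurableT_comp => //; apply: measurable_funB => //.
  exact: measurableT_comp.
have f0 z : (0 <= f z)%E.
  by have /andP[Fz _] := F01 (z.1 - S z.2); rewrite /f lee_fin; do ! apply: mulr_ge0 => //; exact: expR_ge0.
transitivity (\int[lebesgue_measure]_(L in (setT : set mR)) \int[P]_w f (L, w))%E.
  rewrite /laplace integral_mkcond; apply: eq_integral => L _; rewrite patchE.
  rewrite /f /= indicE; case: ifPn => [LD|LD].
    rewrite EFinM phiE -ge0_integralZl//.
    - by apply: eq_integral => w _; rewrite mul1r.
    - by apply/measurable_EFinP; exact: measurable_funM.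
    - by move=> w _; rewrite lee_fin mulr_ge0//; have /andP[] := F01 (L - S w).
  by rewrite integral0_eq// => w _; rewrite mul0r.
rewrite (fubini_tonelli (m1 := lebesgue_measure) (m2 := P) f)//.
transitivity (\int[P]_w (laplace F s * (expR (- (s * S w)) * W w)%:E))%E.
  apply: eq_integral => w _.
  transitivity (laplace (fun L => F (L - S w)) s * (W w)%:E)%E; last first.
    have F0 y : 0 <= F y by have /andP[] := F01 y.
    by rewrite (laplace_shift s mF F0 FN (S0 w)) (EFinM (expR _) (W w)) [RHS]muleA (muleC (laplace F s)).
  have mLF : measurable_fun (setT : set mR) (fun L => (expR (- (s * L)) * F (L - S w))%:E).
    apply/measurable_EFinP; apply: measurable_funM.
      by do 2 apply: measurableT_comp => //; exact: measurable_funM.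
    by apply: measurableT_comp => //; exact: measurable_funB.
  rewrite /laplace -ge0_integralZr//.
  - rewrite [RHS]integral_mkcond; apply: eq_integral => L _.
    rewrite patchE /f /= indicE; case: ifPn => _; last by rewrite mul0r.
    by rewrite mul1r -EFinM mulrA.
  - exact: measurable_funTS.
  - by move=> L _; have /andP[FL _] := F01 (L - S w); rewrite lee_fin mulr_ge0 ?expR_ge0.
  - by rewrite lee_fin.
rewrite ge0_integralZl//.
- by rewrite integral_weight.
- apply/measurable_EFinP; apply: measurable_funM => //.
  by do 2 apply: measurableT_comp => //; exact: measurable_funM.
- by move=> w _; rewrite lee_fin mulr_ge0 ?expR_ge0.
- apply: integral_ge0 => L _.
  by have /andP[FL _] := F01 L; rewrite lee_fin mulr_ge0 ?expR_ge0.
Qed.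

Let integral_mark_fin_num (f : R * R -> R) : measurable_fun setT f ->
  (forall v, 0 <= f v) -> (forall v, 0 <= v.1 -> 0 <= v.2 -> f v <= 1) ->
  ((\int[mu]_v (f v)%:E)%E \is a fin_num) && (fine (\int[mu]_v (f v)%:E)%E <= 1).
Proof.
move=> mf f0 f1; rewrite integral_mark_law//.
have mfV : measurable_fun setT (fun w => f (V1 1 w, V2 1 w)) by exact: (measurableT_comp mf (mVi 0)).
have f01 w : 0 <= f (V1 1 w, V2 1 w) <= 1.
  by have [v1 v2] := V0 w (ltn0Sn 0); rewrite f0 f1.
by rewrite integral01_fin_num//= -lee_fin fineK ?integral01_fin_num ?integral01_le1.
Qed.

Lemma nu_exponent_indep s : 0 <= s ->
  (forall A B : set R, measurable A -> measurable B ->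
      mu (A `*` B) = (mu (A `*` setT) * mu (setT `*` B))%E) ->
  nu_exponent lam q mu t s = - Lambda lam t + a_coef lam q mu t * mu2_lt mu s.
Proof.
move=> s0 indep_mu; congr (_ + _).
have mexp (u : R) : measurable_fun (setT : set R) (fun x => expR (- (u * x))).
  by do 2 apply: measurableT_comp => //; exact: measurable_funM.
have exp1 (u x : R) : 0 <= u -> 0 <= x -> expR (- (u * x)) <= 1.
  by move=> u0 x0; rewrite expR_le1 oppr_le0 mulr_ge0.
have fin1 u : 0 <= u ->
    ((\int[mu]_v (expR (- (u * v.1)))%:E)%E \is a fin_num) && (mu1_lt mu u <= 1).
  move=> u0; apply: integral_mark_fin_num => [|v|v v1 _]; last exact: exp1.
  - exact: (measurableT_comp (mexp u)).
  - exact: expR_ge0.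
have fin2 : ((\int[mu]_v (expR (- (s * v.2)))%:E)%E \is a fin_num) && (mu2_lt mu s <= 1).
  apply: integral_mark_fin_num => [|v|v _ v2]; last exact: exp1.
  - exact: (measurableT_comp (mexp s)).
  - exact: expR_ge0.
have mu_lt_prod u : 0 <= u -> mu_lt mu u s = mu1_lt mu u * mu2_lt mu s.
  move=> u0; rewrite /mu_lt.
  under eq_integral do rewrite expRD.
  have := integral_indep_prod indep_mu (mexp u) (mexp s) (fun=> expR_ge0 _) (fun=> expR_ge0 _).
  move=> ->; have /andP[f1 _] := fin1 u u0; have /andP[f2 _] := fin2.
  by rewrite fineM.
have mu1_ge0 u : 0 <= mu1_lt mu u.
  by apply: fine_ge0; apply: integral_ge0 => v _; rewrite lee_fin expR_ge0.
have mmu1 : measurable_fun (setT : set mR) (fun w => mu1_lt mu (t - w)).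
  rewrite (_ : (fun _ => _) = fine \o (fun w => \int[mu]_v (expR (- ((t - w) * v.1)))%:E)%E)//.
  apply: measurableT_comp => //.
  apply: (measurable_fun_fubini_tonelli_F (m2 := mu)
    (fun z : mR * (R * R) => (expR (- ((t - z.1) * z.2.1)))%:E)).
    apply/measurable_EFinP; do 2 apply: measurableT_comp => //.
    by apply: measurable_funM; [exact: measurable_funB|exact: measurableT_comp].
  by move=> z; rewrite lee_fin expR_ge0.
have ia : lebesgue_measure.-integrable `[0, t]%classic
    (EFin \o (fun w => mu1_lt mu (t - w) * q w * lam w)).
  apply: (le_integrable _ _ _ (ilam t0)) => //.
  - apply/measurable_funTS/measurable_EFinP; apply: measurable_funM => //.
    exact: measurable_funM.
  - move=> x /=; rewrite in_itv/= => /andP[_ xt].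
    have /andP[q0 q1] := q01 x.
    have /andP[_ m1] := fin1 (t - x) (etrans (subr_ge0 _ _) xt).
    rewrite lee_fin ger0_norm ?mulr_ge0// ger0_norm// ler_piMl//.
    by rewrite mulr_ile1.
rewrite [RHS](_ : _ = Rintegral lebesgue_measure `[0, t]%classic
  (fun w => mu1_lt mu (t - w) * q w * lam w * mu2_lt mu s)); last first.
  by rewrite RintegralZr.
rewrite /Rintegral; apply: (congr1 fine); apply: eq_integral => w wt0.
have wt : w <= t by move: wt0; rewrite inE/= in_itv/= => /andP[].
apply: (congr1 EFin); rewrite (mu_lt_prod _ (etrans (subr_ge0 _ _) wt)).
by move: (mu1_lt mu (t - w)) (mu2_lt mu s) (q w) (lam w) => a b c e; ring.
Qed.

End shock_model.

Theorem theorem1 (R : realType) (d : measure_display) (Omega : measurableType d)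
  (P : probability Omega R)
  (lam : R -> R) (N : R -> Omega -> nat) (T : nat -> Omega -> R)
  (V1 V2 : nat -> Omega -> R) (mu : probability (R * R)%type R)
  (G : R -> Omega -> R) (q : R -> R) (t : R) :
  (* intensity *)
  measurable_fun setT lam ->
  (forall x, 0 <= lam x) ->
  (forall x, 0 <= x ->
     lebesgue_measure.-integrable `[0%R, x]%classic (fun y => (lam y)%:E)) ->
  (forall x, 0 < x -> 0 < Lambda lam x) ->
  (* non-homogeneous Poisson process with points T_1, T_2, ... *)
  nhpp P lam N T ->
  (* marks V_i = (V1 i, V2 i), i >= 1: non-negative, i.i.d. with law mu *)
  (forall i, (0 < i)%N -> measurable_fun setT (fun w => (V1 i w, V2 i w))) ->
  (forall i w, (0 < i)%N -> 0 <= V1 i w /\ 0 <= V2 i w) ->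
  (forall i (B : set (R * R)%type), (0 < i)%N -> measurable B ->
     P ((fun w => (V1 i w, V2 i w)) @^-1` B) = mu B) ->
  (* G: non-decreasing, non-negative process *)
  (forall s, 0 <= s -> measurable_fun setT (G s)) ->
  (forall s u w, 0 <= s <= u -> 0 <= G s w <= G u w) ->
  (* q : [0,oo) -> [0,1] *)
  measurable_fun setT q ->
  (forall x, 0 <= q x <= 1) ->
  (* (N_t), V_1, V_2, ..., (G_t) mutually independent *)
  indep P (shock_family N V1 V2 G) ->
  0 <= t ->
  (exists nu : {measure set R -> \bar R}, is_nu lam q mu t nu) /\
  (forall nu : {measure set R -> \bar R}, is_nu lam q mu t nu ->
     (forall s, 0 <= s ->
        laplace (shock_phi P N T V1 V2 G q t) s =
        (laplace (cdfG P (G t)) s * (expR (nu_exponent lam q mu t s))%:E)%E) /\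
     (forall L, 0 <= L ->
        (shock_phi P N T V1 V2 G q t L)%:E =
        (\int[nu]_(x in `[0%R, +oo[%classic) (cdfG P (G t) (L - x))%:E)%E)) /\
  ((forall A B : set R, measurable A -> measurable B ->
      mu (A `*` B) = (mu (A `*` setT) * mu (setT `*` B))%E) ->
   forall s, 0 <= s ->
     expR (nu_exponent lam q mu t s) =
     expR (- Lambda lam t + a_coef lam q mu t * mu2_lt mu s)).
Proof.
move=> mlam lam0 ilam _ HN mV V0 lawV mG G0 mq q01 indepF t0; split; last split.
- exact: (exists_nu mlam lam0 ilam HN mV V0 lawV mG mq q01 indepF t0).
- move=> nu is_nu_nu; split=> [s s0|L _].
    exact: (laplace_shock_phi mlam lam0 ilam HN mV V0 lawV mG G0 mq q01 indepF t0).
  exact: (shock_phi_conv mlam lam0 ilam HN mV V0 lawV mG mq q01 indepF t0).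
- move=> indep_mu s s0; congr expR.
  exact: (nu_exponent_indep mlam lam0 ilam mV V0 lawV mq q01 t0).
Qed.
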